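(* Let $H$ be a real separable Hilbert space, let $L=(L_t)_{t\ge 0}$ be an $H$-valued Lévy process with generating triplet $(m,Q,\nu)$, and let $(P_t)_{t\ge 0}$ be its transition semigroup, $P_tf(x)=\mathbb{E}\,f(x+L_t)$. Then for arbitrary $f\in B_b(H)$, $$ \int_H\left\vert P_tf(x+y)-P_tf(x)\right\vert^2\,\nu(\mathrm{d}y)\le\frac1t\,P_tf^2(x)\qquad\text{for all }x\in H,\ t>0. $$
   Context: $B_b(H)$ is the space of bounded Borel measurable functions $f\colon H\to\mathbb{R}$. Generating triplet: $m\in H$, $Q\colon H\to H$ is a symmetric non-negative trace class operator, and $\nu$ (the Lévy measure) is a Borel measure on $H$ with $\nu(\{0\})=0$ and $\int_H 1\wedge|y|_H^2\,\nu(\mathrm{d}y)<\infty$, such that $\mathbb{E}\,e^{\mathrm{i}\langle x,L_t\rangle_H}=e^{-t\psi(x)}$ for $x\in H$, $t\ge0$, where $$\psi(x)=-\mathrm{i}\langle x,m\rangle_H+\tfrac12\langle Qx,x\rangle_H-\int_H\left[e^{\mathrm{i}\langle x,y\rangle_H}-1-\mathrm{i}\langle x,y\rangle_H\mathbf{1}_{\{|y|_H\le1\}}\right]\nu(\mathrm{d}y).$$ The transition semigroup is $P_tf(x)=\mathbb{E}\,f(x+L_t)$ for $t\ge0$, $x\in H$, $f\in B_b(H)$; $P_tf^2$ means $P_t(f^2)$. *)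

(* Defs.v *)
From HB Require Import structures.
From mathcomp Require Export all_boot all_order all_algebra.
From mathcomp Require Export all_classical all_reals all_analysis.
From mathcomp Require Export complex.
Export Order.TTheory GRing.Theory Num.Theory.
Export numFieldNormedType.Exports.

Set Implicit Arguments.
Unset Strict Implicit.
Unset Printing Implicit Defensive.

Local Open Scope classical_set_scope.
Local Open Scope ring_scope.
Local Open Scope complex_scope.

HB.mixin Record CompleteNormedModule_isHilbert (R : realType) H
    & CompleteNormedModule R H := {
  inner : H -> H -> R ;
  innerC : forall x y : H, inner x y = inner y x ;
  inner_linear : forall (y : H) (a : R) (x1 x2 : H),
    inner (a *: x1 + x2) y = a * inner x1 y + inner x2 y ;
  inner_norm : forall x : H, inner x x = `|x| ^+ 2 }.

#[short(type="hilbertType")]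
HB.structure Definition Hilbert (R : realType) :=
  {H of CompleteNormedModule R H & CompleteNormedModule_isHilbert R H}.

Notation "'<< x , y >>_H" := (inner x y)
  (at level 0, x, y at level 50, format "''<<' x ,  y '>>_H'") : ring_scope.

Definition separable (T : topologicalType) : Prop :=
  exists D : set T, countable D /\ dense D.

Definition borel (T : ptopologicalType) := g_sigma_algebraType (@open T).

(* Nuclear representation; it forces T to be bounded and, over a Hilbert
   space, it is the usual definition of the trace class. *)
Definition trace_class (R : realType) (H : hilbertType R)
    (T : {linear H -> H}) : Prop :=
  exists a b : nat -> H,
    cvgn (series (fun k => `|a k| * `|b k|)) /\
    forall x : H, series (fun k => '<<x, a k>>_H *: b k) @ \oo --> T x.

Definition symmetric_op (R : realType) (H : hilbertType R)
    (T : {linear H -> H}) : Prop :=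
  forall x y : H, '<<T x, y>>_H = '<<x, T y>>_H.

Definition nonnegative_op (R : realType) (H : hilbertType R)
    (T : {linear H -> H}) : Prop :=
  forall x : H, 0 <= '<<T x, x>>_H.

Definition cexp (R : realType) (z : R[i]) : R[i] :=
  (expR (complex.Re z))%:C * (cos (complex.Im z) +i* sin (complex.Im z)).

Definition cintegral d (T : measurableType d) (R : realType)
    (mu : {measure set T -> \bar R}) (f : T -> R[i]) : R[i] :=
  (\int[mu]_w complex.Re (f w)) +i* (\int[mu]_w complex.Im (f w)).

(* Paths are indexed by all of R, but only the values at times t >= 0 are
   constrained. In the independence clause, the events for a subfamily of the
   increments are obtained with B i = setT for the remaining indices. *)
Record levy_process (R : realType) (H : hilbertType R) (d : measure_display)
    (Omega : measurableType d) (P : probability Omega R)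
    (L : R -> Omega -> H) : Prop := LevyProcess {
  levy_measurable : forall t : R, 0 <= t ->
    measurable_fun setT (L t : Omega -> borel H) ;
  levy_start : {ae P, forall w, L 0 w = 0} ;
  levy_independent_increments : forall (n : nat) (t : nat -> R)
      (B : nat -> set (borel H)),
    0 <= t 0%N -> {homo t : i j / (i <= j)%N >-> i <= j} ->
    (forall i, measurable (B i)) ->
    P (\bigcap_(i < n) [set w | B i (L (t i.+1) w - L (t i) w)]) =
    (\prod_(i < n) P [set w | B i (L (t i.+1) w - L (t i) w)%R])%E ;
  levy_stationary_increments : forall (s t : R) (B : set (borel H)),
    0 <= s -> s <= t -> measurable B ->
    P [set w | B (L t w - L s w)] = P [set w | B (L (t - s) w)] ;
  levy_stochastic_continuity : forall t eps : R, 0 <= t -> 0 < eps ->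
    P [set w | eps < `|L s w - L t w|]
      @[s --> within [set u : R | 0 <= u] (nbhs t)] --> 0%E }.

Definition levy_exponent (R : realType) (H : hilbertType R) (m : H)
    (Q : {linear H -> H}) (nu : {measure set (borel H) -> \bar R})
    (x : H) : R[i] :=
  - ('i%C * ('<<x, m>>_H)%:C) + (2^-1 * '<<Q x, x>>_H)%:C
  - cintegral nu (fun y : H =>
      cexp ('i%C * ('<<x, y>>_H)%:C) - 1
      - 'i%C * ('<<x, y>>_H * \1_[set z : H | `|z| <= 1] y)%:C).

Record generating_triplet (R : realType) (H : hilbertType R)
    (d : measure_display) (Omega : measurableType d) (P : probability Omega R)
    (L : R -> Omega -> H) (m : H) (Q : {linear H -> H})
    (nu : {measure set (borel H) -> \bar R}) : Prop := GeneratingTriplet {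
  triplet_Q_symmetric : symmetric_op Q ;
  triplet_Q_nonnegative : nonnegative_op Q ;
  triplet_Q_trace_class : trace_class Q ;
  triplet_nu0 : nu [set (0 : H)] = 0%E ;
  triplet_nu_levy :
    (\int[nu]_y (Num.min 1 (`|(y : H)| ^+ 2))%:E < +oo)%E ;
  triplet_characteristic_function : forall (x : H) (t : R), 0 <= t ->
    cintegral P (fun w => cexp ('i%C * ('<<x, L t w>>_H)%:C)) =
    cexp (- (t%:C * levy_exponent m Q nu x)) }.

Definition bounded_borel (R : realType) (H : hilbertType R) (f : H -> R) : Prop :=
  measurable_fun setT (f : borel H -> R) /\ bounded_fun f.

Definition transition_semigroup (R : realType) (H : hilbertType R)
    (d : measure_display) (Omega : measurableType d) (P : probability Omega R)
    (L : R -> Omega -> H) (t : R) (f : H -> R) (x : H) : R :=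
  fine 'E_P[fun w => f (x + L t w)].

(* Main.v *)
Require Import Defs.
From mathcomp Require Import finmap measurable_realfun ring lra.

(* For a trigonometric polynomial f = sum_i a_i e^(i<xi_i, .>) both sides are
   Hermitian forms in b_i = a_i e^(i<xi_i, x>) e^(-t psi(xi_i)).  With
   A_jk = psi(xi_j) + conj psi(xi_k) - psi(xi_j - xi_k), the left-hand side is
   the form of A minus the nonnegative form of Q, and P_t f^2 (x) is the form of
   the entrywise exponential e^(tA); so it suffices that
   e^(tA) - tA is positive semidefinite.  As e^(sA) - 1 is the covariance
   kernel of the random variables e^(s psi(xi_j)) e^(i<xi_j, L_s>), entrywise
   multiplication by it preserves positivity.  Bernoulli's inequality applied
   to (1 + (e^(tA/n) - 1))^n then gives e^(tA) - 1 - n (e^(tA/n) - 1) >= 0, and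
   n tends to infinity.
   The inequality is stable under bounded pointwise limits (Fatou), and every
   bounded Borel function is obtained from trigonometric polynomials by
   iterating such limits, because H is separable. *)

Set Implicit Arguments.
Unset Strict Implicit.
Unset Printing Implicit Defensive.

Local Open Scope classical_set_scope.
Local Open Scope ring_scope.
Local Open Scope complex_scope.

(** * Integrals of complex functions *)

Section ComplexIntegral.
Context {R : realType} {d : measure_display} {T : measurableType d}.
Variable mu : {measure set T -> \bar R}.
Implicit Types (f g : T -> R[i]) (c : R[i]).

Definition cintegrable f : Prop :=
  mu.-integrable setT (EFin \o (fun w => complex.Re (f w))) /\
  mu.-integrable setT (EFin \o (fun w => complex.Im (f w))).

Lemma ReD (z w : R[i]) : complex.Re (z + w) = complex.Re z + complex.Re w.
Proof. by case: z => ? ?; case: w. Qed.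

Lemma ImD (z w : R[i]) : complex.Im (z + w) = complex.Im z + complex.Im w.
Proof. by case: z => ? ?; case: w. Qed.

Lemma ReM (z w : R[i]) :
  complex.Re (z * w) = complex.Re z * complex.Re w - complex.Im z * complex.Im w.
Proof. by case: z => ? ?; case: w. Qed.

Lemma ImM (z w : R[i]) :
  complex.Im (z * w) = complex.Re z * complex.Im w + complex.Im z * complex.Re w.
Proof. by case: z => ? ?; case: w. Qed.

Lemma complex_ext (z w : R[i]) :
  complex.Re z = complex.Re w -> complex.Im z = complex.Im w -> z = w.
Proof. by case: z => a b; case: w => c e /= -> ->. Qed.

Lemma cintegrableD f g :
  cintegrable f -> cintegrable g -> cintegrable (fun w => f w + g w).
Proof.
move=> [f1 f2] [g1 g2]; split.
- apply: eq_integrable (integrableD _ f1 g1) => // w _ /=.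
  by rewrite ReD EFinD.
- apply: eq_integrable (integrableD _ f2 g2) => // w _ /=.
  by rewrite ImD EFinD.
Qed.

Lemma cintegralD f g : cintegrable f -> cintegrable g ->
  cintegral mu (fun w => f w + g w) = cintegral mu f + cintegral mu g.
Proof.
move=> [f1 f2] [g1 g2]; apply: complex_ext.
- rewrite ReD /= -RintegralD//; apply: eq_Rintegral => w _; exact: ReD.
- rewrite ImD /= -RintegralD//; apply: eq_Rintegral => w _; exact: ImD.
Qed.

Lemma integrable_lincomb (a b : R) (u v : T -> R) :
  mu.-integrable setT (EFin \o u) -> mu.-integrable setT (EFin \o v) ->
  mu.-integrable setT (EFin \o (fun w => a * u w + b * v w)).
Proof.
move=> iu iv.
have := integrableD measurableT (integrableZl measurableT a iu)
  (integrableZl measurableT b iv).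
by apply: eq_integrable.
Qed.

Lemma Rintegral_lincomb (a b : R) (u v : T -> R) :
  mu.-integrable setT (EFin \o u) -> mu.-integrable setT (EFin \o v) ->
  \int[mu]_w (a * u w + b * v w) = a * \int[mu]_w u w + b * \int[mu]_w v w.
Proof.
move=> iu iv.
have iau : mu.-integrable setT (EFin \o (fun w => a * u w)).
  exact: eq_integrable (integrableZl measurableT a iu).
have ibv : mu.-integrable setT (EFin \o (fun w => b * v w)).
  exact: eq_integrable (integrableZl measurableT b iv).
by rewrite RintegralD// !RintegralZl.
Qed.

Lemma cintegrableZ c f : cintegrable f -> cintegrable (fun w => c * f w).
Proof.
move=> [f1 f2]; split.
- apply: eq_integrable (integrable_lincomb (complex.Re c) (- complex.Im c) f1 f2) => //.
  by move=> w _ /=; rewrite ReM mulNr.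
- apply: eq_integrable (integrable_lincomb (complex.Re c) (complex.Im c) f2 f1) => //.
  by move=> w _ /=; rewrite ImM.
Qed.

Lemma cintegralZ c f : cintegrable f ->
  cintegral mu (fun w => c * f w) = c * cintegral mu f.
Proof.
move=> [f1 f2]; apply: complex_ext.
- rewrite ReM -mulNr /= -Rintegral_lincomb//; apply: eq_Rintegral => w _.
  by rewrite ReM mulNr.
- rewrite ImM /= -Rintegral_lincomb//; apply: eq_Rintegral => w _.
  by rewrite ImM.
Qed.

Lemma cintegrable0 : cintegrable (fun=> 0).
Proof. by split; exact: integrable0. Qed.

Lemma cintegrable_sum (I : Type) (r : seq I) (f : I -> T -> R[i]) :
  (forall i, cintegrable (f i)) -> cintegrable (fun w => \sum_(i <- r) f i w).
Proof.
move=> fi; elim: r => [|i r IH].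
  by under [X in cintegrable X]eq_fun do rewrite big_nil; exact: cintegrable0.
under [X in cintegrable X]eq_fun do rewrite big_cons.
exact: cintegrableD.
Qed.

Lemma cintegral_sum (I : Type) (r : seq I) (f : I -> T -> R[i]) :
  (forall i, cintegrable (f i)) ->
  cintegral mu (fun w => \sum_(i <- r) f i w) = \sum_(i <- r) cintegral mu (f i).
Proof.
move=> fi; elim: r => [|i r IH].
  under [X in cintegral _ X]eq_fun do rewrite big_nil; rewrite big_nil.
  by apply: complex_ext; rewrite /= /Rintegral integral0.
under [X in cintegral _ X]eq_fun do rewrite big_cons.
by rewrite cintegralD ?big_cons ?IH//; exact: cintegrable_sum.
Qed.

Lemma cintegrable_conj f : cintegrable f -> cintegrable (fun w => (f w)^*%C).
Proof.
move=> [f1 f2]; split.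
- apply: (eq_integrable measurableT _ _ _ f1) => w _ /=.
  by case: (f w).
- apply: (eq_integrable measurableT _ _ _ (integrableN f2)) => w _ /=.
  by case: (f w).
Qed.

Lemma cintegral_conj f : cintegrable f ->
  cintegral mu (fun w => (f w)^*%C) = (cintegral mu f)^*%C.
Proof.
move=> [f1 f2]; apply: complex_ext => /=.
- by apply: eq_Rintegral => w _; case: (f w).
- rewrite -mulN1r -RintegralZl//; apply: eq_Rintegral => w _.
  by case: (f w) => a b /=; rewrite mulN1r.
Qed.

Lemma cintegral_ge0 f : (forall w, 0 <= f w) -> 0 <= cintegral mu f.
Proof.
move=> f0; rewrite lecE /=; apply/andP; split.
  under eq_Rintegral do rewrite ger0_Im//.
  by rewrite Rintegral_cst// mul0r.
by apply: Rintegral_ge0 => w _; move: (f0 w); rewrite lecE => /andP[].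
Qed.

End ComplexIntegral.

(** * Bounded measurable complex functions *)

Section BoundedMeasurable.
Context {R : realType} {d : measure_display} {T : measurableType d}.
Implicit Types (f g : T -> R[i]) (c : R[i]).

Definition cbounded_measurable f : Prop :=
  [/\ measurable_fun setT (fun w => complex.Re (f w)),
      measurable_fun setT (fun w => complex.Im (f w)) &
      exists M : R, forall w, `|complex.Re (f w)| <= M /\ `|complex.Im (f w)| <= M].

Lemma cbounded_measurable_cst c : cbounded_measurable (fun=> c).
Proof.
split; [exact: measurable_cst..|].
exists (`|complex.Re c| + `|complex.Im c|) => _; split;
  by rewrite ?lerDl ?lerDr.
Qed.

Lemma cbounded_measurableD f g : cbounded_measurable f -> cbounded_measurable g ->
  cbounded_measurable (fun w => f w + g w).
Proof.
move=> [f1 f2 [M fM]] [g1 g2 [N gN]]; split.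
- by under eq_fun do rewrite ReD; exact: measurable_funD.
- by under eq_fun do rewrite ImD; exact: measurable_funD.
exists (M + N) => w; rewrite ReD ImD.
by split; rewrite (le_trans (ler_normD _ _))// lerD// ?(fM w).1 ?(fM w).2 ?(gN w).1 ?(gN w).2.
Qed.

Lemma cbounded_measurableM f g : cbounded_measurable f -> cbounded_measurable g ->
  cbounded_measurable (fun w => f w * g w).
Proof.
move=> [f1 f2 [M fM]] [g1 g2 [N gN]]; split.
- by under eq_fun do rewrite ReM; apply: measurable_funB; exact: measurable_funM.
- by under eq_fun do rewrite ImM; apply: measurable_funD; exact: measurable_funM.
exists (M * N + M * N) => w; rewrite ReM ImM.
have [fr fi] := fM w; have [gr gi] := gN w.
by split; rewrite (le_trans (ler_normD _ _))// ?normrN lerD// normrM ler_pM.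
Qed.

Lemma cbounded_measurable_conj f : cbounded_measurable f ->
  cbounded_measurable (fun w => (f w)^*%C).
Proof.
move=> [f1 f2 [M fM]]; split.
- by apply: eq_measurable_fun f1 => w _; case: (f w).
- apply: eq_measurable_fun (measurable_funN f2) => w _ /=.
  by case: (f w).
by exists M => w; have := fM w; case: (f w) => a b /=; rewrite normrN.
Qed.

Lemma cbounded_measurable_integrable (mu : {finite_measure set T -> \bar R}) f :
  cbounded_measurable f -> cintegrable mu f.
Proof.
have bnd (u : T -> R) M : measurable_fun setT u -> (forall w, `|u w| <= M) ->
    mu.-integrable setT (EFin \o u).
  move=> mu_ uM; apply: (le_integrable measurableT _ _
    (finite_measure_integrable_cst mu M measurableT)).
  - exact/measurable_EFinP.
  - move=> w _ /=; rewrite lee_fin; apply: le_trans (uM w) (ler_norm _).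
move=> [f1 f2 [M fM]]; split; apply: (bnd _ M) => // w.
- exact: (fM w).1.
- exact: (fM w).2.
Qed.

End BoundedMeasurable.

(** * Positive semidefinite kernels and the complex exponential *)

Section ComplexExp.
Context {R : realType}.
Implicit Types (z w : R[i]).

Definition cis (u : R) : R[i] := cos u +i* sin u.

Lemma cexp_i u : cexp ('i%C * u%:C) = cis u.
Proof.
rewrite /cexp ReM ImM /= !(mul0r, mul1r, mulr0, subr0, oppr0, addr0, add0r).
by rewrite expR0 rmorph1 mul1r.
Qed.

Lemma cisD u v : cis (u + v) = cis u * cis v.
Proof.
by apply: complex_ext; rewrite ?ReM ?ImM /= ?cosD ?sinD// addrC (mulrC (sin u)).
Qed.

Lemma cis0 : cis 0 = 1.
Proof. by rewrite /cis cos0 sin0. Qed.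

Lemma cisJ u : (cis u)^*%C = cis (- u).
Proof. by rewrite /cis cosN sinN. Qed.

Lemma cexpD z w : cexp (z + w) = cexp z * cexp w.
Proof.
rewrite /cexp ReD ImD expRD -!/(cis _) cisD rmorphM /=.
ring.
Qed.

Lemma cexp0 : cexp (0 : R[i]) = 1.
Proof. by rewrite /cexp /= expR0 -/(cis 0) cis0 mulr1. Qed.

Lemma cexpN z : cexp (- z) * cexp z = 1.
Proof. by rewrite -cexpD addNr cexp0. Qed.

Lemma cexpJ z : (cexp z)^*%C = cexp (z^*%C).
Proof.
by case: z => a b; rewrite /cexp /= cosN sinN; apply: complex_ext => /=; ring.
Qed.

Lemma cexpMn n z : cexp (n%:R * z) = cexp z ^+ n.
Proof.
elim: n => [|n IH]; first by rewrite mul0r cexp0 expr0.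
by rewrite -natr1 mulrDl mul1r cexpD IH exprSr.
Qed.

(* The difference quotient is only taken of the real part of a multiple of the
   exponential, so that no topology on [R[i]] is needed. *)
Lemma cvg_cexp_quotient (a z : R[i]) :
  (fun n => n.+1%:R * complex.Re (a * (cexp (n.+1%:R^-1%:C * z) - 1)))
    @ \oo --> complex.Re (a * z).
Proof.
case: z => x y; case: a => a b.
(* [h s] is the real part of (a + ib) e^(s(x + iy)). The sequence in the statement is its difference
   quotient at 0 along s = 1/(n+1), and its derivative at 0 is ax - by. *)
pose h (s : R) := a * (expR (s * x) * cos (s * y)) - b * (expR (s * x) * sin (s * y)).
have hE s : complex.Re ((a +i* b) * (cexp (s%:C * (x +i* y)) - 1)) = h s - h 0.
  rewrite /h !mul0r expR0 cos0 sin0 /cexp !(ReM, ReD, ImM, ImD) /=.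
  rewrite !(mul0r, subr0, addr0); ring.
have dh : is_derive (0 : R) 1 h (a * x - b * y).
  rewrite /h; apply: is_derive_eq.
  rewrite /GRing.scale /= !mul0r expR0 cos0 sin0; ring.
have [dh1 dh2] := dh.
have qh : (fun s => s^-1 *: (h (s + 0) - h 0)) @ 0^' --> a * x - b * y.
  rewrite -dh2; move: dh1; rewrite /derivable /derive.
  by under eq_fun do rewrite [_ *: 1]mulr1.
have hn : (forall n, @harmonic R n != 0) /\ @harmonic R @ \oo --> 0.
  by split=> [n|]; [rewrite /= invr_eq0 pnatr_eq0|exact: cvg_harmonic].
have := (cvgr_dnbhsP _ _ _).1 qh _ hn.
under eq_fun do rewrite addr0 invrK.
by under [in X in _ -> X]eq_fun do rewrite hE.
Qed.

End ComplexExp.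

(** * Positive semidefinite kernels under entrywise products *)

Section PositiveKernels.
Context {R : realType} {I : finType}.
Implicit Types (K B D A : I -> I -> R[i]).

(** In the order of [R[i]], [0 <= z] says that z is real and nonnegative, so such a kernel is
    automatically Hermitian. *)
Definition psd K : Prop :=
  forall c : I -> R[i], 0 <= \sum_j \sum_k c j * (c k)^*%C * K j k.

Lemma psdD K B : psd K -> psd B -> psd (fun j k => K j k + B j k).
Proof.
move=> hK hB c; have := addr_ge0 (hK c) (hB c).
rewrite -big_split; congr (0 <= _); apply: eq_bigr => j _.
by rewrite -big_split; apply: eq_bigr => k _; rewrite mulrDr.
Qed.

Lemma psd0 : psd (fun _ _ => 0).
Proof. by move=> c; rewrite big1// => j _; rewrite big1// => k _; rewrite mulr0. Qed.

Lemma psdMn n K : psd K -> psd (fun j k => n%:R * K j k).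
Proof.
move=> hK c; have := mulr_ge0 (ler0n _ n) (hK c).
rewrite mulr_sumr; congr (0 <= _); apply: eq_bigr => j _.
by rewrite mulr_sumr; apply: eq_bigr => k _; rewrite mulrCA.
Qed.

(** The induction behind Bernoulli's inequality, with entrywise products: if E_n denotes the kernel,
    then E_(n+1) = E_n + E_n D + n D D, and multiplication by [D] preserves [psd]. *)
Lemma psd_bernoulli D n :
  (forall B, psd B -> psd (fun j k => B j k * D j k)) -> psd D ->
  psd (fun j k => (1 + D j k) ^+ n - 1 - n%:R * D j k).
Proof.
move=> DB D0; elim: n => [|n IH].
  have := psd0; congr psd; apply/funext => j; apply/funext => k.
  by rewrite expr0 subrr mul0r subr0.
have := psdD (psdD IH (DB _ IH)) (psdMn n (DB _ D0)).
congr psd; apply/funext => j; apply/funext => k.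
by rewrite exprS -natr1; ring.
Qed.

(** Schur's product theorem for a Gram kernel: the form of the product at c is the integral over w
    of the form of [B] at the vector with entries c_j G_j(w), and this integrand is nonnegative. *)
Lemma psd_gram {d} {T : measurableType d} (mu : {measure set T -> \bar R})
    (G : I -> T -> R[i]) B :
  (forall j k, cintegrable mu (fun w => G j w * (G k w)^*%C)) ->
  psd B -> psd (fun j k => B j k * cintegral mu (fun w => G j w * (G k w)^*%C)).
Proof.
move=> iG hB c.
rewrite [X in 0 <= X](_ : _ = cintegral mu (fun w => \sum_j \sum_k
    (c j * G j w) * (c k * G k w)^*%C * B j k)).
  by apply: cintegral_ge0 => w; exact: (hB (fun j => c j * G j w)).
have iGB j k : cintegrable mu (fun w => c j * G j w * (c k * G k w)^*%C * B j k).
  have := cintegrableZ (c j * (c k)^*%C * B j k) (iG j k).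
  by congr cintegrable; apply/funext => w; rewrite rmorphM /=; ring.
rewrite cintegral_sum; last by move=> j; exact: cintegrable_sum.
apply: eq_bigr => j _; rewrite cintegral_sum//; apply: eq_bigr => k _.
rewrite mulrA -cintegralZ//; congr cintegral; apply/funext => w.
by rewrite rmorphM /=; ring.
Qed.

(** With D = e^(tA/n) - 1, adding the all-ones kernel to the kernel of [psd_bernoulli] gives (1 +
    D)^n - nD = e^(tA) - nD, which is therefore psd. As n grows, the form of nD tends to that of tA
    in real part. *)
Lemma psd_cexp_le A (t : R) (c : I -> R[i]) : 0 < t ->
  (forall s B, 0 <= s -> psd B -> psd (fun j k => B j k * (cexp (s%:C * A j k) - 1))) ->
  complex.Re (\sum_j \sum_k c j * (c k)^*%C * (t%:C * A j k)) <=
  complex.Re (\sum_j \sum_k c j * (c k)^*%C * cexp (t%:C * A j k)).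
Proof.
move=> t0 hA.
have psd1 : psd (fun _ _ => 1).
  move=> e; rewrite [X in 0 <= X](_ : _ = (\sum_j e j) * (\sum_j e j)^*%C).
    exact: mulcJ_ge0.
  rewrite mulr_suml; apply: eq_bigr => j _; rewrite rmorph_sum mulr_sumr /=.
  by apply: eq_bigr => k _; rewrite mulr1.
have ReS (F : I -> I -> R[i]) : complex.Re (\sum_j \sum_k F j k) =
    \sum_j \sum_k complex.Re (F j k).
  rewrite (big_morph _ (@ReD R) (erefl : complex.Re 0 = 0)); apply: eq_bigr => j _.
  by rewrite (big_morph _ (@ReD R) (erefl : complex.Re 0 = 0)).
have step n : n.+1%:R * \sum_j \sum_k complex.Re (c j * (c k)^*%C *
      (cexp (n.+1%:R^-1%:C * (t%:C * A j k)) - 1)) <=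
    complex.Re (\sum_j \sum_k c j * (c k)^*%C * cexp (t%:C * A j k)).
  pose D j k := cexp ((n.+1%:R^-1 * t)%:C * A j k) - 1.
  have s0 : 0 <= n.+1%:R^-1 * t by rewrite mulr_ge0// ltW.
  have DB B : psd B -> psd (fun j k => B j k * D j k) by exact: hA.
  have D0 : psd D.
    have := DB _ psd1; congr psd; apply/funext => j; apply/funext => k.
    by rewrite mul1r.
  have := addr_ge0 (psd_bernoulli n.+1 DB D0 c) (psd1 c).
  rewrite -big_split /=; under eq_bigr do rewrite -big_split /=.
  rewrite lecE => /andP[_ hn]; rewrite -subr_ge0; move: hn.
  rewrite !ReS /= mulr_sumr -sumrB.
  congr (0 <= _); apply: eq_bigr => j _.
  rewrite mulr_sumr -sumrB; apply: eq_bigr => k _.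
  have -> : n.+1%:R^-1%:C * (t%:C * A j k) = (n.+1%:R^-1 * t)%:C * A j k.
    by rewrite rmorphM mulrA.
  have -> : cexp (t%:C * A j k) = cexp ((n.+1%:R^-1 * t)%:C * A j k) ^+ n.+1.
    have nE : t%:C = n.+1%:R * (n.+1%:R^-1 * t)%:C :> R[i].
      rewrite -(rmorph_nat (real_complex R)) -rmorphM mulrA mulfV ?mul1r//.
    by rewrite [in LHS]nE -mulrA cexpMn.
  rewrite /D addrCA subrr addr0 mulr1.
  set u := _ ^+ _; set v := cexp _ - 1; set e := _ * _^*%C.
  have -> : e * (u - 1 - n.+1%:R * v) + e = e * u + - (n.+1%:R%:C * (e * v)).
    by rewrite rmorph_nat; ring.
  rewrite ReD; congr (_ + _).
  by case: (e * v) => x y; rewrite /= mul0r subr0.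
have cv : (fun n => n.+1%:R * \sum_j \sum_k complex.Re (c j * (c k)^*%C *
      (cexp (n.+1%:R^-1%:C * (t%:C * A j k)) - 1))) @ \oo -->
    complex.Re (\sum_j \sum_k c j * (c k)^*%C * (t%:C * A j k)).
  rewrite ReS; under eq_fun do rewrite mulr_sumr.
  apply: cvg_big => [|j _]; [exact: add_continuous|under eq_fun do rewrite mulr_sumr].
  by apply: cvg_big => [|k _]; [exact: add_continuous|exact: cvg_cexp_quotient].
rewrite -(cvg_lim _ cv)//; apply: limr_le; first by apply/cvg_ex; eexists; exact: cv.
exact: nearW.
Qed.

End PositiveKernels.

(** * Closure under bounded pointwise limits *)

Lemma bernoulli_ge {R : realFieldType} (y : R) n : -1 <= y -> 1 + n%:R * y <= (1 + y) ^+ n.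
Proof.
move=> y1; elim: n => [|n IH]; first by rewrite mul0r addr0 expr0.
rewrite exprS; apply: le_trans (ler_wpM2l _ IH); last by lra.
have : 0 <= n%:R * y ^+ 2 by rewrite mulr_ge0// sqr_ge0.
by rewrite -natr1; nra.
Qed.

(* The Brosowski-Deutsch polynomials [(1 - x^n)^(2^n)] tend to 1 for x < 1/2 and
   to 0 for x > 1/2; the factor s removes the point s = 0, where x = 1/2 and the
   limit is 1/e. *)
Lemma cvg_min0_poly {R : realType} (s : R) : -1 <= s <= 1 ->
  (fun n => s * (1 - ((1 + s) / 2) ^+ n) ^+ (2 ^ n)) @ \oo --> Num.min s 0.
Proof.
move=> /andP[s1 s2]; pose x := (1 + s) / 2.
have x01 n : 0 <= x ^+ n <= 1 by rewrite exprn_ge0 ?exprn_ile1 /x//=; lra.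
have xE n : (2 ^ n)%:R * x ^+ n = (1 + s) ^+ n.
  by rewrite natrX -exprMn /x mulrC divfK.
have p01 n : 0 <= (1 - x ^+ n) ^+ (2 ^ n) <= 1.
  have /andP[x0 x1] := x01 n.
  by rewrite exprn_ge0 ?exprn_ile1 ?subr_ge0// lerBlDr lerDl.
have [s0|s0|->] := ltgtP s 0; last first.
- under eq_fun do rewrite mul0r; exact: cvg_cst.
- rewrite -[X in _ --> X](mulr0 s); apply: cvgM; first exact: cvg_cst.
  apply: (@squeeze_cvgr _ _ _ _ (cst 0) (fun n => (1 + s)^-1 ^+ n)); last 2 first.
  + exact: cvg_cst.
  + apply: cvg_expr; rewrite ger0_norm ?invr_ge0; last by lra.
    by rewrite invf_lt1; lra.
  apply: nearW => n; have /andP[-> _] := p01 n; rewrite /= exprVn.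
  have /andP[x0 x1] := x01 n.
  rewrite -[leRHS]mul1r ler_pdivlMr ?exprn_gt0//; last by lra.
  (* Bernoulli's inequality gives (1 + s)^n = 2^n x^n <= (1 + x^n)^(2^n), and the product of the two
     powers is (1 - x^(2n))^(2^n) <= 1. *)
  apply: (@le_trans _ _ ((1 - x ^+ n) ^+ (2 ^ n) * (1 + x ^+ n) ^+ (2 ^ n))).
    rewrite ler_wpM2l ?exprn_ge0 ?subr_ge0// -xE.
    by apply: le_trans (bernoulli_ge _ _); lra.
  by rewrite -exprMn exprn_ile1//; nra.
- rewrite -[X in _ --> X]mulr1; apply: cvgM; first exact: cvg_cst.
  (* The lower bound is again Bernoulli's inequality, since 2^n x^n = (1 + s)^n. *)
  apply: (@squeeze_cvgr _ _ _ _ (fun n => 1 - (1 + s) ^+ n) (cst 1)); last 2 first.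
  + rewrite -[X in _ --> X]subr0; apply: cvgB; first exact: cvg_cst.
    by apply: cvg_expr; rewrite ger0_norm; lra.
  + exact: cvg_cst.
  apply: nearW => n; have /andP[_ ->] := p01 n; rewrite andbT -xE -mulrN.
  by apply: bernoulli_ge; have /andP[x0 x1] := x01 n; lra.
Qed.

Section BoundedClosure.
Context {R : realType} {T : Type}.
Implicit Types (f g : T -> R) (A C : set (T -> R)).

Definition bounded_limit_closed C : Prop :=
  forall (u : nat -> T -> R) f (M : R), (forall n, C (u n)) ->
    (forall n z, `|u n z| <= M) -> (forall z, u^~ z @ \oo --> f z) -> C f.

(** Intersecting all closed classes replaces a transfinite iteration of limits and gives the
    induction principle [bounded_closure_ind] directly. *)
Definition bounded_closure A : set (T -> R) :=
  [set f | forall C, A `<=` C -> bounded_limit_closed C -> C f].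

Lemma sub_bounded_closure A : A `<=` bounded_closure A.
Proof. by move=> f Af C sAC _; exact: sAC. Qed.

Lemma bounded_closure_closed A : bounded_limit_closed (bounded_closure A).
Proof.
move=> u f M Au uM uf C sAC CC; apply: (CC u f M) => // n.
exact: Au.
Qed.

Lemma bounded_closure_ind A C :
  A `<=` C -> bounded_limit_closed C -> bounded_closure A `<=` C.
Proof. by move=> sAC CC f; exact. Qed.

Variable A : set (T -> R).
Hypothesis A_bounded : forall f, A f -> exists M : R, forall z, `|f z| <= M.
Hypothesis A_cst : forall a : R, A (cst a).
Hypothesis A_add : forall f g, A f -> A g -> A (f \+ g).
Hypothesis A_mul : forall f g, A f -> A g -> A (f \* g).
Local Notation B := (bounded_closure A).

Lemma bounded_closure_bounded f : B f -> exists M : R, forall z, `|f z| <= M.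
Proof.
apply: (bounded_closure_ind A_bounded) => u g M _ uM ug; exists M => z.
have ugz : (fun n => `|u n z|) @ \oo --> `|g z| by apply: cvg_norm; exact: ug.
rewrite -(cvg_lim _ ugz)//; apply: limr_le.
  by apply/cvg_ex; eexists; exact: ugz.
by apply: nearW => n; exact: uM.
Qed.

Lemma bounded_closure_cst (a : R) : B (cst a).
Proof. exact: sub_bounded_closure. Qed.

(** Two inductions: first [f] is fixed in [A] while [g] runs through the closure, then [g] is fixed
    in the closure while [f] runs through it. The bound on [op] keeps the composed sequences
    uniformly bounded. *)
Lemma bounded_closure_op (op : R -> R -> R) :
  continuous (fun p : R * R => op p.1 p.2) ->
  (forall M N : R, exists K : R, forall a b, `|a| <= M -> `|b| <= N -> `|op a b| <= K) ->
  (forall f g, A f -> A g -> A (fun z => op (f z) (g z))) ->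
  forall f g, B f -> B g -> B (fun z => op (f z) (g z)).
Proof.
move=> op_cont op_bd op_A.
have cvg_op (u v : nat -> R) a b : u @ \oo --> a -> v @ \oo --> b ->
    (fun n => op (u n) (v n)) @ \oo --> op a b.
  by move=> ua vb; apply: continuous2_cvg ua vb; exact: (op_cont (a, b)).
have step1 f : A f -> forall g, B g -> B (fun z => op (f z) (g z)).
  move=> Af; apply: bounded_closure_ind => [g Ag|u g M Bu uM ug].
    by apply: sub_bounded_closure; exact: op_A.
  have [N fN] := A_bounded Af; have [K opK] := op_bd N M.
  apply: (@bounded_closure_closed _ (fun n z => op (f z) (u n z)) _ K) => // [n z|z].
    exact: opK.
  by apply: cvg_op; [exact: cvg_cst|exact: ug].
move=> f g Bf Bg; move: f Bf; apply: bounded_closure_ind => [f Af|u f M Bu uM uf].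
  exact: step1.
have [N gN] := bounded_closure_bounded Bg; have [K opK] := op_bd M N.
apply: (@bounded_closure_closed _ (fun n z => op (u n z) (g z)) _ K) => // [n z|z].
  exact: opK.
by apply: cvg_op; [exact: uf|exact: cvg_cst].
Qed.

Lemma bounded_closureD f g : B f -> B g -> B (fun z => f z + g z).
Proof.
apply: bounded_closure_op => //; first exact: (@add_continuous R).
move=> M N; exists (M + N) => a b aM bN.
by rewrite (le_trans (ler_normD _ _))// lerD.
Qed.

Lemma bounded_closureM f g : B f -> B g -> B (fun z => f z * g z).
Proof.
apply: bounded_closure_op => //; first exact: (@mul_continuous R).
by move=> M N; exists (M * N) => a b aM bN; rewrite normrM ler_pM.
Qed.

Lemma bounded_closureZ a f : B f -> B (fun z => a * f z).
Proof. by move=> Bf; apply: bounded_closureM => //; exact: bounded_closure_cst. Qed.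

Lemma bounded_closureB f g : B f -> B g -> B (fun z => f z - g z).
Proof.
move=> Bf Bg; have := bounded_closureD Bf (bounded_closureZ (-1) Bg).
by under eq_fun do rewrite mulN1r.
Qed.

Lemma bounded_closureX n f : B f -> B (fun z => f z ^+ n).
Proof.
move=> Bf; elim: n => [|n IH].
  by under eq_fun do rewrite expr0; exact: bounded_closure_cst.
by under eq_fun do rewrite exprS; exact: bounded_closureM.
Qed.

Lemma bounded_closure_sum (I : Type) (r : seq I) (P : pred I) (F : I -> T -> R) :
  (forall i, B (F i)) -> B (fun z => \sum_(i <- r | P i) F i z).
Proof.
move=> BF; elim: r => [|i r IH].
  by under eq_fun do rewrite big_nil; exact: bounded_closure_cst.
under eq_fun do rewrite big_cons.
by case: (P i) => //; exact: bounded_closureD.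
Qed.

(** This turns the approximation of functions into a question about sets: the class is a
    sigma-algebra, and once it contains the measurable sets, simple functions lead to all bounded
    measurable functions. *)
Definition closure_sets : set (set T) := [set S | B (\1_S)].

Lemma closure_setsC S : closure_sets S -> closure_sets (~` S).
Proof.
move=> BS; rewrite /closure_sets /=.
rewrite (_ : \1_(~` S) = (fun z => cst 1 z - \1_S z)).
  exact: bounded_closureB (bounded_closure_cst 1) BS.
by apply/funext => z; rewrite indicC /= indicE; case: (_ \in _); rewrite /= ?subrr ?subr0.
Qed.

Lemma closure_setsI S S' : closure_sets S -> closure_sets S' -> closure_sets (S `&` S').
Proof.
move=> BS BS'; rewrite /closure_sets /=.
rewrite (_ : \1_(S `&` S') = (fun z => \1_S z * \1_S' z)).
  exact: bounded_closureM.
by apply/funext => z; rewrite indicI.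
Qed.

Lemma closure_sets_limit (u : nat -> T -> R) S (M : R) : (forall n, B (u n)) ->
  (forall n z, `|u n z| <= M) -> (forall z, u^~ z @ \oo --> (\1_S z : R)) ->
  closure_sets S.
Proof. exact: bounded_closure_closed. Qed.

Lemma closure_sets_bigcap (F : nat -> set T) :
  (forall n, closure_sets (F n)) -> closure_sets (\bigcap_n F n).
Proof.
move=> BF; pose G n := \bigcap_(i < n) F i.
have BG n : closure_sets (G n).
  elim: n => [|n IH]; rewrite /G.
    rewrite bigcap_mkord big_ord0 /closure_sets /= indicT.
    exact: bounded_closure_cst.
  by rewrite bigcap_mkord big_ord_recr /= -bigcap_mkord; exact: closure_setsI.
apply: (@closure_sets_limit (fun n => \1_(G n)) _ 1) => // [n z|z].
  by rewrite indicE; case: (_ \in _); rewrite ?normr1 ?normr0.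
have [Fz|/existsNP[n /not_implyP[_ nFz]]] := pselect ((\bigcap_n F n) z).
  rewrite indicE mem_set//; apply: cvg_near_cst; apply: nearW => n.
  by rewrite indicE mem_set// => i _; exact: Fz.
rewrite [X in _ --> X]indicE memNset/=; last by move=> /(_ n I).
(* [G m] intersects the indices below m only, so [F n] takes part from m = n + 1 on. *)
apply: cvg_near_cst; exists n.+1 => // m /= nm.
by rewrite indicE memNset// => /(_ n nm).
Qed.

Lemma closure_sets_sigma : sigma_algebra setT closure_sets.
Proof.
have B0 : closure_sets set0.
  by rewrite /closure_sets /= indic0; exact: bounded_closure_cst.
split => // [S BS|F BF]; first by rewrite setTD; exact: closure_setsC.
rewrite -[X in closure_sets X]setCK setC_bigcup; apply: closure_setsC.
by apply: closure_sets_bigcap => n; exact: closure_setsC.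
Qed.

(** The polynomials of [cvg_min0_poly], evaluated at [f], belong to the closure, stay bounded by 1
    and converge pointwise to the minimum. *)
Lemma bounded_closure_min0 f : B f -> (forall z, `|f z| <= 1) ->
  B (fun z => Num.min (f z) 0).
Proof.
move=> Bf f1.
pose u n z := f z * (1 - ((1 + f z) / 2) ^+ n) ^+ (2 ^ n).
apply: (@bounded_closure_closed _ u _ 1) => [n|n z|z].
- apply: bounded_closureM => //; apply: bounded_closureX.
  apply: bounded_closureB; first exact: bounded_closure_cst.
  apply: bounded_closureX; apply: bounded_closureM; last exact: bounded_closure_cst.
  by apply: bounded_closureD => //; exact: bounded_closure_cst.
- have := f1 z; rewrite ler_norml => /andP[f1z f2z].
  rewrite /u normrM -[leRHS]mulr1 ler_pM// normrX exprn_ile1//.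
  have : 0 <= ((1 + f z) / 2) ^+ n <= 1 by rewrite exprn_ge0 ?exprn_ile1//=; lra.
  by rewrite ler_norml; lra.
- by apply: cvg_min0_poly; rewrite -ler_norml.
Qed.

(** For g = min(-f, 0), the function 1 + g takes values in [0, 1] and equals 1 exactly where f <= 0.
    Hence 1 - (1 + g)^n converges pointwise to the indicator. *)
Lemma closure_sets_gt0 f : B f -> (forall z, `|f z| <= 1) ->
  closure_sets [set z | 0 < f z].
Proof.
move=> Bf f1; pose g z := Num.min (- f z) 0.
have Bg : B g.
  apply: bounded_closure_min0 => [|z]; last by rewrite normrN.
  by under eq_fun do rewrite -mulN1r; exact: bounded_closureZ.
have g01 z : 0 <= 1 + g z <= 1.
  have := f1 z; rewrite ler_norml => /andP[f1z f2z].
  by rewrite /g; case: (leP (- f z) 0); lra.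
apply: (@closure_sets_limit (fun n z => 1 - (1 + g z) ^+ n) _ 1) => [n|n z|z].
- apply: bounded_closureB; first exact: bounded_closure_cst.
  by apply: bounded_closureX; apply: bounded_closureD => //; exact: bounded_closure_cst.
- have /andP[g0 g1] := g01 z.
  have : 0 <= (1 + g z) ^+ n <= 1 by rewrite exprn_ge0 ?exprn_ile1.
  by rewrite ler_norml; lra.
- rewrite indicE; have [fz|fz] := boolP (0 < f z).
    rewrite mem_set// -[X in _ --> X]subr0; apply: cvgB; first exact: cvg_cst.
    apply: cvg_expr; have /andP[g0 g1] := g01 z.
    by rewrite ger0_norm// gtrDl /g min_l ?oppr_lt0 ?oppr_le0 ?ltW.
  rewrite memNset/=; last exact/negP.
  have -> : g z = 0 by rewrite /g min_r// oppr_ge0 leNgt.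
  by under eq_fun do rewrite addr0 expr1n subrr; exact: cvg_cst.
Qed.

End BoundedClosure.

Lemma bounded_funP {R : realType} {T : Type} (f : T -> R) :
  bounded_fun f -> exists M : R, forall z, `|f z| <= M.
Proof.
move=> [M [_ fM]]; exists (M + 1) => z.
by apply: fM; rewrite ?ltrDl.
Qed.

(** * Bounded measurable functions as iterated bounded limits *)

Section BoundedClosureMeasurable.
Import HBNNSimple.
Context {R : realType} {d : measure_display} {T : measurableType d}.
Variable A : set (T -> R).
Hypothesis A_bounded : forall f, A f -> exists M : R, forall z, `|f z| <= M.
Hypothesis A_cst : forall a : R, A (cst a).
Hypothesis A_add : forall f g, A f -> A g -> A (f \+ g).
Hypothesis A_mul : forall f g, A f -> A g -> A (f \* g).
Hypothesis A_sets : measurable `<=` closure_sets A.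

(** f + M is nonnegative, hence a pointwise limit of simple functions between 0 and 2M. These are
    finite linear combinations of indicators supplied by [A_sets]; the constant M is subtracted at
    the end. *)
Lemma bounded_closure_measurable (f : T -> R) :
  measurable_fun setT f -> (exists M : R, forall z, `|f z| <= M) ->
  bounded_closure A f.
Proof.
move=> mf [M fM].
have mg : measurable_fun setT (fun z => (f z + M)%:E).
  by apply/measurable_EFinP; apply: measurable_funD => //; exact: measurable_cst.
pose g := nnsfun_approx measurableT mg.
have g0 z : [set: T] z -> (0 <= (f z + M)%:E)%E.
  by move=> _; rewrite lee_fin; have := fM z; rewrite ler_norml; lra.
have Bg n : bounded_closure A (g n).
  rewrite (_ : (g n : T -> R) = (fun z => \sum_(y <- fset_set (range (g n)))
      y * \1_((g n : T -> R) @^-1` [set y]) z)).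
    apply: bounded_closure_sum => // y; apply: bounded_closureZ => //.
    by apply: A_sets; exact: measurable_sfunP.
  by apply/funext => z; rewrite [LHS]fimfunE fsbig_finite.
have gf : bounded_closure A (fun z => f z + M).
  apply: (@bounded_closure_closed _ _ A (fun n => g n) _ (M + M)) => // [n z|z].
    rewrite ger0_norm; last exact: fun_ge0.
    rewrite -lee_fin; apply: le_trans (_ : (f z + M)%:E <= _)%E; last first.
      by rewrite lee_fin; have := fM z; rewrite ler_norml; lra.
    by rewrite /g nnsfun_approxE; exact: (le_approx _ g0).
  have /fine_cvgP[_] := cvg_nnsfun_approx measurableT mg g0 I (x := z).
  exact.
have := bounded_closureB A_bounded A_cst A_add A_mul gf (bounded_closure_cst A_cst M).
by under eq_fun do rewrite addrK.
Qed.

End BoundedClosureMeasurable.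

(** * Hilbert space and trigonometric polynomials *)

Section Inner.
Context {R : realType} {H : hilbertType R}.
Implicit Types (x y z : H).

Lemma innerDl x y z : '<<x + y, z>>_H = '<<x, z>>_H + '<<y, z>>_H.
Proof. by rewrite -[x]scale1r inner_linear mul1r scale1r. Qed.

Lemma inner0l z : '<<(0 : H), z>>_H = 0.
Proof.
have := innerDl 0 0 z; rewrite addr0 => /eqP.
by rewrite -subr_eq0 opprD addNKr oppr_eq0 => /eqP.
Qed.

Lemma inner0r z : '<<z, (0 : H)>>_H = 0.
Proof. by rewrite innerC inner0l. Qed.

Lemma innerZl (a : R) x z : '<<a *: x, z>>_H = a * '<<x, z>>_H.
Proof. by rewrite -[a *: x]addr0 inner_linear inner0l addr0. Qed.

Lemma innerNl x z : '<<- x, z>>_H = - '<<x, z>>_H.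
Proof. by rewrite -scaleN1r innerZl mulN1r. Qed.

Lemma innerBl x y z : '<<x - y, z>>_H = '<<x, z>>_H - '<<y, z>>_H.
Proof. by rewrite innerDl innerNl. Qed.

Lemma innerDr x y z : '<<x, y + z>>_H = '<<x, y>>_H + '<<x, z>>_H.
Proof. by rewrite innerC innerDl !(innerC x). Qed.

Lemma innerBr x y z : '<<x, y - z>>_H = '<<x, y>>_H - '<<x, z>>_H.
Proof. by rewrite innerC innerBl !(innerC x). Qed.

Lemma innerZr (a : R) x z : '<<x, a *: z>>_H = a * '<<x, z>>_H.
Proof. by rewrite innerC innerZl (innerC x). Qed.

Lemma cauchy_schwarz x y : `|'<<x, y>>_H| <= `|x| * `|y|.
Proof.
have [->|x0] := eqVneq x 0; first by rewrite inner0l !normr0 mul0r.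
rewrite -(@ler_pXn2r _ 2) ?nnegrE ?mulr_ge0// exprMn -!inner_norm real_normK ?num_real//.
have xx0 : 0 < '<<x, x>>_H by rewrite inner_norm exprn_gt0 ?normr_gt0.
(* This squared norm expands to |x|^2 times (|x|^2 |y|^2 - <x, y>^2). *)
have : 0 <= '<<'<<x, x>>_H *: y - '<<x, y>>_H *: x, '<<x, x>>_H *: y - '<<x, y>>_H *: x>>_H.
  by rewrite inner_norm exprn_ge0.
rewrite !(innerBl, innerBr, innerZl, innerZr) (innerC y x) => h.
rewrite -subr_ge0 -(pmulr_rge0 _ xx0); apply: le_trans h _.
by rewrite le_eqVlt; apply/orP; left; apply/eqP; ring.
Qed.

Lemma inner_continuous x : continuous (fun y : H => '<<x, y>>_H).
Proof.
move=> y; apply/cvgrPdist_le => e e0.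
have d0 : 0 < e / (`|x| + 1) by rewrite divr_gt0// ltr_wpDl.
near=> z; rewrite -innerBr.
have zy : `|y - z| <= e / (`|x| + 1).
  by near: z; apply: (@cvgr_dist_le _ _ _ (nbhs y) _ id y); first exact: cvg_id.
apply: le_trans (cauchy_schwarz _ _) _.
apply: le_trans (ler_wpM2l _ zy) _ => //.
rewrite mulrCA ger_pMr// ler_pdivrMr ?mul1r ?ler_wpDr//.
Unshelve. all: by end_near. Qed.

Lemma continuous_borel (f : H -> R) : continuous f ->
  measurable_fun setT (f : borel H -> R).
Proof.
move=> cf; apply: (measurability _ (RGenOInfty.measurableE R)) => _ [_ [a ->] <-].
rewrite setTI; apply: sub_sigma_algebra.
by move/continuousP : cf; apply; exact: interval_open.
Qed.

Lemma inner_measurable x : measurable_fun setT (fun y : borel H => '<<x, y : H>>_H).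
Proof. exact: (continuous_borel (@inner_continuous x)). Qed.

Lemma norm_measurable : measurable_fun setT (fun y : borel H => `|y : H|).
Proof. by apply: (continuous_borel (f := fun y : H => `|y|)); exact: norm_continuous. Qed.

End Inner.

(** * Trigonometric polynomials and the Borel sets they generate *)

Section TrigPoly.
Context {R : realType} {H : hilbertType R}.
Implicit Types (f g : H -> R).

(** Leaving the finite index type free lets a sum be indexed by the disjoint union and a product by
    the cartesian product; frequencies may repeat. *)
Definition trig_poly : set (H -> R) :=
  [set f | exists (I : finType) (a : I -> R[i]) (xi : I -> H),
    forall z, (f z)%:C = \sum_i a i * cis '<<xi i, z>>_H].

Lemma trig_poly_cst (a : R) : trig_poly (cst a).
Proof.
exists unit, (fun=> a%:C), (fun=> 0) => z.
by rewrite big_const card_unit /= inner0l cis0 mulr1 addr0.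
Qed.

Lemma trig_polyD f g : trig_poly f -> trig_poly g -> trig_poly (f \+ g).
Proof.
move=> [I [a [xi fE]]] [J [b [eta gE]]].
exists (I + J)%type, (fun k => match k with inl i => a i | inr j => b j end),
  (fun k => match k with inl i => xi i | inr j => eta j end) => z.
by rewrite big_sumType /= rmorphD /= fE gE.
Qed.

Lemma trig_polyM f g : trig_poly f -> trig_poly g -> trig_poly (f \* g).
Proof.
move=> [I [a [xi fE]]] [J [b [eta gE]]].
exists (I * J)%type, (fun k => a k.1 * b k.2), (fun k => xi k.1 + eta k.2) => z.
rewrite rmorphM /= fE gE big_distrlr /= pair_bigA /=; apply: eq_bigr => k _.
by rewrite innerDl cisD mulrACA.
Qed.

Lemma trig_poly_bounded f : trig_poly f -> exists M : R, forall z, `|f z| <= M.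
Proof.
move=> [I [a [xi fE]]].
exists (\sum_i (`|complex.Re (a i)| + `|complex.Im (a i)|)) => z.
have -> : f z = \sum_i complex.Re (a i * cis '<<xi i, z>>_H).
  by rewrite -(big_morph _ (@ReD R) (erefl : complex.Re 0 = 0)) -fE.
apply: le_trans (ler_norm_sum _ _ _) _; apply: ler_sum => i _.
rewrite ReM /=; apply: le_trans (ler_normB _ _) _.
by rewrite !normrM lerD// ler_piMr// ?cos_max ?sin_max.
Qed.

Lemma trig_poly_sin (e : H) (c : R) : trig_poly (fun z => sin ('<<e, z>>_H + c)).
Proof.
(* This is e^(ic) / (2i), from Euler's formula for the sine; its conjugate belongs to the frequency
   [- e]. *)
pose a := (sin c / 2) +i* (- cos c / 2).
exists bool, (fun b => if b then a else a^*%C), (fun b => if b then e else - e) => z.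
rewrite big_bool /= innerNl /cis cosN sinN sinD.
by apply: complex_ext => /=; field.
Qed.

Local Notation S := (closure_sets trig_poly).

(** Put u = <e, z> - c. Once |u| / (n+1) < pi, the sine of u / (n+1) is positive exactly when u is,
    so at each point the indicators of the sets [F n] are eventually equal to that of the
    half-space. *)
Lemma closure_sets_halfspace (e : H) (c : R) : S [set z | c < '<<e, z>>_H].
Proof.
pose F n := [set z : H | 0 < sin ('<<n.+1%:R^-1 *: e, z>>_H + - (n.+1%:R^-1 * c))].
apply: (@closure_sets_limit _ _ _ (fun n => \1_(F n)) _ 1) => [n|n z|z].
- apply: closure_sets_gt0 => //.
  + exact: trig_poly_bounded.
  + exact: trig_poly_cst.
  + exact: trig_polyD.
  + exact: trig_polyM.
  + by apply: sub_bounded_closure; exact: trig_poly_sin.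
  + by move=> z; exact: sin_max.
- by rewrite indicE; case: (_ \in _); rewrite ?normr1 ?normr0.
- pose u := '<<e, z>>_H - c; pose N := Num.truncn `|u|.
  apply: cvg_near_cst; exists N => // n /= Nn.
  have n0 : (0 : R) < n.+1%:R by rewrite ltr0n.
  have uN : `|u| / n.+1%:R < pi.
    apply: lt_le_trans (pi_ge2 R); rewrite ltr_pdivrMr//.
    have h : `|u| < n.+1%:R by apply: lt_le_trans (truncnS_gt _) _; rewrite ler_nat.
    by lra.
  have FE : F n z = (c < '<<e, z>>_H) :> Prop.
    rewrite /F /= innerZl -mulrBr -/u mulrC -[X in _ = is_true X]subr_gt0 -/u.
    have [u0|u0] := ltP 0 u.
      by rewrite sin_gt0_pi// divr_gt0//= -(gtr0_norm u0).
    rewrite -[u]opprK mulNr sinN oppr_gt0 ltNge sin_ge0_pi//.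
    by rewrite divr_ge0 ?oppr_ge0//= -(ler0_norm u0) ltW.
  have [cz|cz] := boolP (c < '<<e, z>>_H).
    by rewrite !indicE !mem_set// FE.
  by rewrite !indicE !memNset// ?FE; exact/negP.
Qed.

Hypothesis hH : separable H.

Lemma separable_seq : exists e : nat -> H, forall O : set H, O !=set0 -> open O ->
  exists n, O (e n).
Proof.
have [D [/countable_injP[p pinj] Ddense]] := hH.
(* The n-th term is the point of [D] with code n, and 0 if there is none. *)
exists (fun n => xget 0 [set z | D z /\ p z = n]) => O O0 oO.
have [z [Oz Dz]] := Ddense _ O0 oO.
exists (p z); case: xgetP => [y _ [Dy pyz]|/(_ z)]; last by case.
by rewrite (pinj y z) ?in_setE//.
Qed.

(** A closed ball is a countable intersection of closed half-spaces with normals in a dense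
    sequence; one inclusion is the Cauchy-Schwarz inequality. *)
Lemma closure_sets_closed_ball (a : H) (r : R) : 0 <= r -> S [set z | `|z - a| <= r].
Proof.
move=> r0; have [e edense] := separable_seq.
rewrite (_ : [set z | `|z - a| <= r] =
    \bigcap_n ~` [set z | '<<e n, a>>_H + r * `|e n| < '<<e n, z>>_H]).
  apply: closure_sets_bigcap => [|||n].
  - exact: trig_poly_bounded.
  - exact: trig_poly_cst.
  - exact: trig_polyM.
  - apply: closure_setsC.
    + exact: trig_poly_bounded.
    + exact: trig_poly_cst.
    + exact: trig_polyD.
    + exact: trig_polyM.
    + exact: closure_sets_halfspace.
apply/seteqP; split=> [z /= zr n _ /=|z /= hz].
  apply/negP; rewrite -leNgt -lerBlDl -innerBr mulrC.
  apply: le_trans (ler_norm _) _; apply: le_trans (cauchy_schwarz _ _) _.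
  by rewrite ler_wpM2l.
rewrite leNgt; apply/negP => rz.
(* If |w| > r, then g(w) > 0, so the open set where g is positive contains some [e n], and the
   half-space with that normal excludes z. *)
pose w := z - a; pose g (y : H) : R := '<<w, y>>_H - r * `|y|.
have cg : continuous g.
  move=> y; apply: cvgB; first exact: inner_continuous.
  by apply: cvgM; [exact: cvg_cst|exact: norm_continuous].
have [||n] := edense (g @^-1` `]0, +oo[).
- exists w; rewrite /= in_itv /= andbT /g inner_norm expr2 -mulrBl mulr_gt0 ?subr_gt0//.
  exact: le_lt_trans rz.
- by move/continuousP : cg; apply; exact: interval_open.
rewrite /= in_itv /= andbT /g subr_gt0 innerC /w innerBr => h.
by apply: (hz n I) => /=; rewrite addrC -ltrBrDr.
Qed.

Lemma open_closure_sets : @open H `<=` S.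
Proof.
move=> U oU; have [e edense] := separable_seq.
have [S0 SD SU] := closure_sets_sigma trig_poly_bounded trig_poly_cst trig_polyD trig_polyM.
(* [F n k] is the closed ball about [e n] of radius 1/(k+1) if that ball lies in [U], and empty
   otherwise. *)
pose F n k := [set z : H | [set y | `|y - e n| <= k.+1%:R^-1 :> R] `<=` U /\
  `|z - e n| <= k.+1%:R^-1].
have -> : U = \bigcup_n \bigcup_k F n k.
  apply/seteqP; split=> [z Uz|z [n _ [k _ [FU zk]]]]; last exact: FU.
  have /nbhs_ballP[eps /= eps0 zU] : nbhs z U by exact: open_nbhs_nbhs.
  (* Chosen so that two radii 1/(k+1) together do not exceed eps: one for the distance from z to the
     centre, one for the ball itself. *)
  pose k := Num.truncn (2 / eps).
  have k0 : (0 : R) < k.+1%:R^-1 by rewrite invr_gt0.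
  have kE : k.+1%:R^-1 + k.+1%:R^-1 <= eps.
    have := truncnS_gt (2 / eps); rewrite -/k ltr_pdivrMr// => h.
    have -> : k.+1%:R^-1 + k.+1%:R^-1 = 2 / k.+1%:R :> R by ring.
    by rewrite ler_pdivrMr// mulrC ltW.
  have [||n] := edense (ball z k.+1%:R^-1).
  - by exists z; exact: ballxx.
  - exact: ball_open.
  rewrite -ball_normE /= => zn; exists n => //; exists k => //; split; last exact: ltW.
  move=> y /= yn; apply: zU; rewrite -ball_normE /=.
  rewrite -[z - y](subrKA (e n)); apply: le_lt_trans (ler_normD _ _) _.
  by apply: lt_le_trans kE; rewrite ltr_leD// distrC.
apply: (SU) => n; apply: (SU) => k; rewrite /F.
have [sU|nU] := pselect ([set y | `|y - e n| <= k.+1%:R^-1 :> R] `<=` U).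
  rewrite (_ : [set _ | _] = [set z | `|z - e n| <= k.+1%:R^-1 :> R]).
    have k0 : 0 <= k.+1%:R^-1 :> R by rewrite invr_ge0.
    exact: closure_sets_closed_ball.
  by apply/seteqP; split=> z /= => [[]|].
rewrite (_ : [set _ | _] = set0)//.
by apply/seteqP; split=> z /= => [[]|].
Qed.

Lemma trig_poly_closure (f : H -> R) : bounded_borel f -> bounded_closure trig_poly f.
Proof.
move=> [mf /bounded_funP fM].
apply: (@bounded_closure_measurable _ _ (borel H)) => //.
- exact: trig_poly_bounded.
- exact: trig_poly_cst.
- exact: trig_polyD.
- exact: trig_polyM.
- apply: smallest_sub; last exact: open_closure_sets.
  exact: (closure_sets_sigma trig_poly_bounded trig_poly_cst trig_polyD trig_polyM).
Qed.

End TrigPoly.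

Lemma continuous_borel_endo {R : realType} {H : hilbertType R} (g : H -> H) :
  continuous g -> measurable_fun setT (g : borel H -> borel H).
Proof.
move=> cg; apply: (@measurability _ _ _ (borel H) _ _ (@open H)) => // _ [U oU <-].
by rewrite setTI; apply: sub_sigma_algebra; move/continuousP : cg; exact.
Qed.

(** * Stability under bounded limits *)

Section Transition.
Context {R : realType} {H : hilbertType R} {d : measure_display}
  {Omega : measurableType d}.
Variables (P : probability Omega R) (L : R -> Omega -> H) (t : R).
Hypothesis mL : measurable_fun setT (L t : Omega -> borel H).
Implicit Types (f : H -> R) (x y : H).

Lemma measurable_shift f y : measurable_fun setT (f : borel H -> R) ->
  measurable_fun setT (fun w => f (y + L t w)).
Proof.
move=> mf; apply: (measurableT_comp (f := f : borel H -> R) mf).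
apply: (measurableT_comp (f := (fun z => y + z) : borel H -> borel H) _ mL).
by apply: continuous_borel_endo => z; apply: cvgD; [exact: cvg_cst|exact: cvg_id].
Qed.

Lemma transition_Rintegral f y :
  transition_semigroup P L t f y = \int[P]_w f (y + L t w).
Proof. by rewrite /transition_semigroup unlock. Qed.

Lemma transition_cvg (u : nat -> H -> R) f (M : R) y :
  (forall n, measurable_fun setT (u n : borel H -> R)) ->
  (forall n z, `|u n z| <= M) -> (forall z, u^~ z @ \oo --> f z) ->
  transition_semigroup P L t (u n) y @[n --> \oo] --> transition_semigroup P L t f y.
Proof.
move=> mu uM uf.
have mf : measurable_fun setT (f : borel H -> R).
  by apply: (@measurable_fun_cvg _ (borel H) _ _ u) => // z _; exact: uf.
under eq_fun do rewrite transition_Rintegral; rewrite transition_Rintegral.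
have [|||||fi _ cv] := @dominated_convergence _ _ _ P setT measurableT
   (fun n w => (u n (y + L t w))%:E) (fun w => (f (y + L t w))%:E) (cst M%:E).
- by move=> n; apply/measurable_EFinP; exact: measurable_shift.
- by apply/measurable_EFinP; exact: measurable_shift.
- by apply: aeW => w _; apply: cvg_EFin; [exact: nearW|exact: uf].
- exact: finite_measure_integrable_cst.
- by apply: aeW => w n _ /=; rewrite lee_fin.
apply: fine_cvg; rewrite fineK//; exact: integrable_fin_num.
Qed.

Variables (nu : {measure set (borel H) -> \bar R}) (x : H).

(** Besides the inequality, the class records the measurability of [f], for the convergence of P_t
    f, and that of the shifted P_t f, for Fatou's lemma, so that an induction over bounded limits
    can pass them on. *)
Definition jump_inequality f : Prop :=
  [/\ measurable_fun setT (f : borel H -> R),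
      exists M : R, forall z, `|f z| <= M,
      measurable_fun setT (fun y : borel H => transition_semigroup P L t f (x + y)) &
  (\int[nu]_y ((`|transition_semigroup P L t f (x + y)
                  - transition_semigroup P L t f x| ^+ 2)%:E)
   <= (t^-1 * transition_semigroup P L t (fun z => f z ^+ 2)%R x)%:E)%E].

Lemma jump_inequality_closed : bounded_limit_closed jump_inequality.
Proof.
move=> u f M hu uM uf.
have mu n : measurable_fun setT (u n : borel H -> R) by case: (hu n).
have mf : measurable_fun setT (f : borel H -> R).
  by apply: (@measurable_fun_cvg _ (borel H) _ _ u) => // z _; exact: uf.
have uPf y := @transition_cvg u f M y mu uM uf.
split=> //.
- exists M => z.
  have ufz : (fun n => `|u n z|) @ \oo --> `|f z| by apply: cvg_norm; exact: uf.
  by apply: (cvgr_to_le ufz); apply: nearW => n; exact: uM.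
- apply: (@measurable_fun_cvg _ (borel H) _ _
    (fun n y => transition_semigroup P L t (u n) (x + y))) => [n|y _].
    by case: (hu n).
  exact: uPf.
have mD n : measurable_fun setT (fun y : borel H => (`|transition_semigroup P L t (u n) (x + y)
    - transition_semigroup P L t (u n) x| ^+ 2)%:E).
  apply/measurable_EFinP; apply: measurable_funX; apply: measurableT_comp => //.
  by apply: measurable_funB; [case: (hu n)|exact: measurable_cst].
have sq : transition_semigroup P L t (fun z => u n z ^+ 2) x @[n --> \oo] -->
    transition_semigroup P L t (fun z => f z ^+ 2) x.
  apply: (@transition_cvg (fun n z => u n z ^+ 2) _ (M ^+ 2)) => [n|n z|z].
  - exact: measurable_funX.
  - by rewrite normrX lerXn2r// nnegrE ?normr_ge0// (le_trans _ (uM n z)).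
  - by rewrite expr2; under eq_fun do rewrite expr2; apply: cvgM; exact: uf.
have rhs : (t^-1 * transition_semigroup P L t (fun z => u n z ^+ 2) x)%:E @[n --> \oo] -->
    (t^-1 * transition_semigroup P L t (fun z => f z ^+ 2) x)%:E.
  by apply: cvg_EFin; [exact: nearW|apply: cvgM; [exact: cvg_cst|exact: sq]].
have lhs y : (`|transition_semigroup P L t (u n) (x + y) -
      transition_semigroup P L t (u n) x| ^+ 2)%:E @[n --> \oo] -->
    (`|transition_semigroup P L t f (x + y) - transition_semigroup P L t f x| ^+ 2)%:E.
  apply: cvg_EFin; first exact: nearW.
  have dP := cvg_norm (cvgB (uPf (x + y)) (uPf x)).
  by rewrite expr2; under eq_fun do rewrite expr2; apply: cvgM; exact: dP.
have D0 n (y : borel H) : [set: borel H] y -> (0 <= (`|transition_semigroup P L t (u n) (x + y)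
    - transition_semigroup P L t (u n) x| ^+ 2)%:E)%E.
  by move=> _; rewrite lee_fin exprn_ge0.
have := fatou nu measurableT mD D0.
under eq_integral do rewrite (cvg_limn_einf_sup (lhs _)).1.
(* The lower limit is the limit of the tail infima; each is at most the first term of its tail,
   which the inequality for [u n] bounds. *)
move=> /le_trans; apply; rewrite limn_einf_lim -(cvg_lim _ rhs)//.
apply: lee_lim => //; first by apply: is_cvg_einfs.
  by apply/cvg_ex; eexists; exact: rhs.
apply: nearW => n; have [_ _ _] := hu n; apply: le_trans.
by apply: ereal_inf_lbound; exists n => /=.
Qed.

End Transition.

(** * Elementary bounds for sine and cosine *)

Section TrigBounds.
Context {R : realType}.
Implicit Types u : R.

Lemma mvt_at0 (f g : R -> R) u : (forall x : R, is_derive x 1 f (g x)) -> f 0 = 0 ->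
  exists2 c, `|c| <= `|u| & f u = g c * u.
Proof.
move=> fg f0; have cf : continuous f.
  by move=> x; apply/differentiable_continuous/derivable1_diffP; have [] := fg x.
have [u0|u0|->] := ltgtP u 0.
- have [|c] := @MVT _ f g u 0 u0 (fun x _ => fg x).
    exact: continuous_subspaceT.
  rewrite in_itv/= => /andP[uc c0]; rewrite f0 !sub0r mulrN => /oppr_inj fu.
  by exists c => //; rewrite !ler0_norm ?lerN2; lra.
- have [|c] := @MVT _ f g 0 u u0 (fun x _ => fg x).
    exact: continuous_subspaceT.
  rewrite in_itv/= => /andP[uc c0]; rewrite f0 !subr0 => fu.
  by exists c => //; rewrite !ger0_norm; lra.
- by exists 0 => //; rewrite f0 mulr0.
Qed.

Lemma norm_sin_le u : `|sin u| <= `|u|.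
Proof.
have [c _ ->] := @mvt_at0 sin cos u (fun x => is_derive_sin x) (@sin0 R).
by rewrite normrM ler_piMl// cos_max.
Qed.

(** Keeping the intermediate point yields the linear bound from |sin c| <= 1 and the quadratic one
    from |sin c| <= |c| <= |u|. *)
Lemma norm_cosB1_le u : exists2 c, `|c| <= `|u| & `|cos u - 1| <= `|sin c| * `|u|.
Proof.
have [x||c cu ->] := @mvt_at0 (fun x => cos x - 1) (fun x => - sin x) u _ _.
- by apply: is_derive_eq; rewrite oppr0 addr0 ?scale1r.
- by rewrite cos0 subrr.
- by exists c => //; rewrite normrM normrN.
Qed.

Lemma norm_cosB1_le1 u : `|cos u - 1| <= `|u|.
Proof.
have [c _ h] := norm_cosB1_le u; apply: le_trans h _.
by rewrite ler_piMl// sin_max.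
Qed.

Lemma norm_cosB1_le2 u : `|cos u - 1| <= u ^+ 2.
Proof.
have [c cu h] := norm_cosB1_le u; apply: le_trans h _.
rewrite -real_normK ?num_real// expr2 ler_wpM2r//.
exact: le_trans (norm_sin_le _) cu.
Qed.

Lemma norm_sinB_le2 u : `|sin u - u| <= u ^+ 2.
Proof.
have [|c cu ->] := @mvt_at0 (fun x => sin x - x) (fun x => cos x - 1) u _ _.
  by rewrite sin0 subrr.
rewrite normrM -[leRHS]real_normK ?num_real// expr2 ler_wpM2r//.
exact: le_trans (norm_cosB1_le1 _) cu.
Qed.

End TrigBounds.

(** * The Levy exponent *)

Section LevyExponent.
Context {R : realType} {H : hilbertType R}.
Variable nu : {measure set (borel H) -> \bar R}.
Hypothesis nu_levy : (\int[nu]_y (Num.min 1 (`|(y : H)| ^+ 2))%:E < +oo)%E.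
Implicit Types (xi y : H).

Lemma integrable_min1_sqr :
  nu.-integrable setT (EFin \o (fun y : borel H => Num.min 1 (`|(y : H)| ^+ 2))).
Proof.
apply/integrableP; split.
  apply/measurable_EFinP; apply: measurable_minr; first exact: measurable_cst.
  by apply: measurable_funX; exact: (@norm_measurable R H).
by under eq_integral do rewrite gee0_abs ?lee_fin ?le_min ?ler01 ?exprn_ge0//.
Qed.

Lemma min1_sqr (a : R) : 0 <= a -> Num.min 1 (a ^+ 2) = Num.min 1 a ^+ 2.
Proof.
move=> a0; have [a1|a1] := leP 1 a.
  by rewrite expr1n min_l// exprn_ege1.
by rewrite min_r// exprn_ile1// ltW.
Qed.

Lemma cintegrable_dominated (h : borel H -> R[i]) (C : R) :
  measurable_fun setT (fun y : borel H => complex.Re (h y)) ->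
  measurable_fun setT (fun y : borel H => complex.Im (h y)) ->
  (forall y : H, `|complex.Re (h y)| <= C * Num.min 1 (`|y| ^+ 2)) ->
  (forall y : H, `|complex.Im (h y)| <= C * Num.min 1 (`|y| ^+ 2)) ->
  cintegrable nu h.
Proof.
have dom (u : borel H -> R) : measurable_fun setT u ->
    (forall y : H, `|u y| <= C * Num.min 1 (`|y| ^+ 2)) ->
    nu.-integrable setT (EFin \o u).
  move=> mu uC; apply: (le_integrable measurableT _ _
    (integrableZl measurableT C integrable_min1_sqr)).
  - exact/measurable_EFinP.
  - move=> y _ /=; rewrite lee_fin; apply: le_trans (uC y) (ler_norm _).
by move=> m1 m2 h1 h2; split; exact: dom.
Qed.

Lemma cis_inner_measurable xi :
  measurable_fun setT (fun y : borel H => cos '<<xi, y : H>>_H) /\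
  measurable_fun setT (fun y : borel H => sin '<<xi, y : H>>_H).
Proof.
split; (apply: measurableT_comp; last exact: inner_measurable);
  apply: continuous_measurable_fun; [exact: continuous_cos|exact: continuous_sin].
Qed.

(** The 2 serves for |y| >= 1, and |xi| comes from the Cauchy-Schwarz inequality for |y| < 1. By
    [min1_sqr], a product of two such bounds is a multiple of the integrable min(1, |y|^2). *)
Lemma cisB1_bound xi y :
  `|cos '<<xi, y>>_H - 1| <= (2 + `|xi|) * Num.min 1 `|y| /\
  `|sin '<<xi, y>>_H| <= (2 + `|xi|) * Num.min 1 `|y|.
Proof.
set u := '<<xi, y>>_H.
have xi0 := normr_ge0 xi; have y0 := normr_ge0 y.
have uxy : `|u| <= `|xi| * `|y| := cauchy_schwarz xi y.
have c1 := norm_cosB1_le1 u; have s1 := norm_sin_le u.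
have c2 : `|cos u - 1| <= 2.
  by apply: le_trans (ler_normB _ _) _; rewrite normr1; have := cos_max u; lra.
have s2 := sin_max u.
by case: (leP 1 `|y|) => y1; split; nra.
Qed.

Lemma cintegrable_cisB1M xi eta :
  cintegrable nu (fun y : borel H =>
    (cis '<<xi, y : H>>_H - 1) * (cis '<<eta, y : H>>_H - 1)^*%C).
Proof.
have [mcx msx] := cis_inner_measurable xi.
have [mce mse] := cis_inner_measurable eta.
have m1 (u v : R) : complex.Re ((cis u - 1) * (cis v - 1)^*%C) =
    (cos u - 1) * (cos v - 1) + sin u * sin v.
  by rewrite ReM /=; ring.
have m2 (u v : R) : complex.Im ((cis u - 1) * (cis v - 1)^*%C) =
    sin u * (cos v - 1) - (cos u - 1) * sin v.
  by rewrite ImM /=; ring.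
apply: (@cintegrable_dominated _ (2 * ((2 + `|xi|) * (2 + `|eta|)))).
- under eq_fun do rewrite m1.
  by apply: measurable_funD; apply: measurable_funM => //;
    apply: measurable_funB => //; exact: measurable_cst.
- under eq_fun do rewrite m2.
  by apply: measurable_funB; apply: measurable_funM => //;
    apply: measurable_funB => //; exact: measurable_cst.
all: move=> y; have [a1 a2] := cisB1_bound xi y; have [b1 b2] := cisB1_bound eta y.
all: have -> : 2 * ((2 + `|xi|) * (2 + `|eta|)) * Num.min 1 (`|y| ^+ 2) =
    (2 + `|xi|) * Num.min 1 `|y| * ((2 + `|eta|) * Num.min 1 `|y|) +
    (2 + `|xi|) * Num.min 1 `|y| * ((2 + `|eta|) * Num.min 1 `|y|)
  by rewrite min1_sqr//; ring.
all: rewrite (m1, m2); apply: le_trans (ler_normD _ _) _.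
all: by rewrite ?normrN lerD// normrM ler_pM.
Qed.

Definition levy_integrand xi y : R[i] :=
  cis '<<xi, y>>_H - 1 - 'i%C * ('<<xi, y>>_H * \1_[set z : H | `|z| <= 1] y)%:C.

(** Inside the unit ball the compensator cancels the linear term and leaves quadratic remainders;
    outside, the integrand is bounded. *)
Lemma cintegrable_levy_integrand xi :
  cintegrable nu (fun y : borel H => levy_integrand xi (y : H)).
Proof.
have [mc ms] := cis_inner_measurable xi.
have m1 y : complex.Re (levy_integrand xi y) = cos '<<xi, y>>_H - 1.
  by rewrite /levy_integrand !ReD /=; ring.
have m2 y : complex.Im (levy_integrand xi y) =
    sin '<<xi, y>>_H - '<<xi, y>>_H * \1_[set z : H | `|z| <= 1] y.
  by rewrite /levy_integrand !ImD /=; ring.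
apply: (@cintegrable_dominated _ (2 + `|xi| ^+ 2)).
- under eq_fun do rewrite m1.
  by apply: measurable_funB => //; exact: measurable_cst.
- under eq_fun do rewrite m2.
  apply: measurable_funB => //; apply: measurable_funM; first exact: inner_measurable.
  apply: measurable_indic; rewrite -[X in measurable X]setTI.
  have := @norm_measurable _ H measurableT `]-oo, (1 : R)]%classic (measurable_itv _).
  by congr measurable; apply/seteqP; split=> z /=; rewrite in_itv.
- move=> y; rewrite m1; set u := '<<xi, y>>_H.
  have uxy : `|u| ^+ 2 <= `|xi| ^+ 2 * `|y| ^+ 2.
    by rewrite -exprMn lerXn2r ?nnegrE ?mulr_ge0//; exact: cauchy_schwarz.
  rewrite real_normK ?num_real// in uxy.
  have c1 := norm_cosB1_le2 u.
  have c2 : `|cos u - 1| <= 2.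
    by apply: le_trans (ler_normB _ _) _; rewrite normr1; have := cos_max u; lra.
  have := exprn_ge0 2 (normr_ge0 xi); have := exprn_ge0 2 (normr_ge0 y).
  by case: (leP 1 (`|y| ^+ 2)) => y1; nra.
- move=> y; rewrite m2; set u := '<<xi, y>>_H.
  have uxy : `|u| ^+ 2 <= `|xi| ^+ 2 * `|y| ^+ 2.
    by rewrite -exprMn lerXn2r ?nnegrE ?mulr_ge0//; exact: cauchy_schwarz.
  rewrite real_normK ?num_real// in uxy.
  have s1 := norm_sinB_le2 u; have s2 := sin_max u.
  have := exprn_ge0 2 (normr_ge0 xi); have y20 := exprn_ge0 2 (normr_ge0 y).
  have [y1|y1] := leP `|y| 1.
    rewrite indicE mem_set//= mulr1 min_r; first by nra.
    by rewrite exprn_ile1.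
  rewrite indicE memNset/=; last by apply/negP; rewrite -ltNge.
  rewrite mulr0 subr0 min_l; first by nra.
  by rewrite exprn_ege1// ltW.
Qed.

Variables (m : H) (Q : {linear H -> H}).

Lemma levy_exponentE xi : levy_exponent m Q nu xi =
  - ('i%C * ('<<xi, m>>_H)%:C) + (2^-1 * '<<Q xi, xi>>_H)%:C
  - cintegral nu (fun y : borel H => levy_integrand xi (y : H)).
Proof.
rewrite /levy_exponent; congr (_ - cintegral nu _); apply/funext => y.
by rewrite cexp_i.
Qed.

(** Drift and compensator are linear in the frequency and cancel. The symmetric quadratic form of
    [Q] leaves its cross term, and the remaining jump integrand factors as (e^(iu) - 1)(e^(-iv) - 1)
    with u = <xi, y> and v = <eta, y>. *)
Lemma levy_exponent_gram xi eta : symmetric_op Q ->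
  levy_exponent m Q nu xi + (levy_exponent m Q nu eta)^*%C -
    levy_exponent m Q nu (xi - eta) =
  cintegral nu (fun y : borel H =>
    (cis '<<xi, y : H>>_H - 1) * (cis '<<eta, y : H>>_H - 1)^*%C) +
  ('<<Q xi, eta>>_H)%:C.
Proof.
move=> symQ.
have -> : cintegral nu (fun y : borel H =>
    (cis '<<xi, y : H>>_H - 1) * (cis '<<eta, y : H>>_H - 1)^*%C) =
  cintegral nu (fun y : borel H => levy_integrand (xi - eta) (y : H)) -
  cintegral nu (fun y : borel H => levy_integrand xi (y : H)) -
  (cintegral nu (fun y : borel H => levy_integrand eta (y : H)))^*%C.
  apply/eqP; rewrite eq_sym !subr_eq; apply/eqP.
  rewrite -cintegral_conj; last exact: cintegrable_levy_integrand.
  have ic := cintegrable_conj (cintegrable_levy_integrand eta).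
  have iM := cintegrable_cisB1M xi eta.
  rewrite -(cintegralD iM ic).
  rewrite -(cintegralD (cintegrableD iM ic) (cintegrable_levy_integrand xi)).
  congr cintegral; apply/funext => y; rewrite /levy_integrand innerBl cisD -cisJ.
  set u := '<<xi, _>>_H; set v := '<<eta, _>>_H.
  apply: complex_ext; rewrite !(ReD, ReM, ImD, ImM) /=; ring.
rewrite !levy_exponentE.
have -> : '<<Q (xi - eta), xi - eta>>_H =
    '<<Q xi, xi>>_H + '<<Q eta, eta>>_H - 2 * '<<Q xi, eta>>_H.
  rewrite linearB !(innerBl, innerBr) (symQ eta xi) (innerC eta); ring.
rewrite innerBl.
move: (cintegral nu _) (cintegral nu _) (cintegral nu _) => [a1 a2] [b1 b2] [c1 c2].
by apply: complex_ext => /=; field.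
Qed.

End LevyExponent.

(** * The inequality for trigonometric polynomials *)

Section TrigInequality.
Context {R : realType} {H : hilbertType R} {d : measure_display}
  {Omega : measurableType d}.
Variables (P : probability Omega R) (L : R -> Omega -> H).
Variables (m : H) (Q : {linear H -> H}) (nu : {measure set (borel H) -> \bar R}).
Hypothesis mL : forall s, 0 <= s -> measurable_fun setT (L s : Omega -> borel H).
Hypothesis tri : generating_triplet P L m Q nu.

Local Notation psi := (levy_exponent m Q nu).

(** The kernel is real and Re(b_j conj b_k) = Re b_j Re b_k + Im b_j Im b_k, so the real part is the
    sum of <Qv, v> over the two vectors v = sum_j Re(b_j) xi_j and v = sum_j Im(b_j) xi_j. *)
Lemma nonnegative_gram (I : finType) (b : I -> R[i]) (xi : I -> H) :
  0 <= complex.Re (\sum_j \sum_k b j * (b k)^*%C * ('<<Q (xi j), xi k>>_H)%:C).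
Proof.
have lin (u : I -> R) :
    \sum_j \sum_k u j * u k * '<<Q (xi j), xi k>>_H =
    '<<Q (\sum_j u j *: xi j), \sum_k u k *: xi k>>_H.
  rewrite linear_sum /= (big_morph (fun z => '<<z, _>>_H) (fun x y => innerDl x y _) (inner0l _)).
  apply: eq_bigr => j _; rewrite innerC.
  rewrite (big_morph (fun z => '<<z, _>>_H) (fun x y => innerDl x y _) (inner0l _)).
  by apply: eq_bigr => k _; rewrite innerZl linearZ /= innerZr innerC; ring.
rewrite (big_morph _ (@ReD R) (erefl : complex.Re 0 = 0)).
under eq_bigr do rewrite (big_morph _ (@ReD R) (erefl : complex.Re 0 = 0)).
have := addr_ge0 (triplet_Q_nonnegative tri (\sum_j complex.Re (b j) *: xi j))
  (triplet_Q_nonnegative tri (\sum_j complex.Im (b j) *: xi j)).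
rewrite -!lin -big_split; congr (0 <= _); apply: eq_bigr => j _.
rewrite -big_split; apply: eq_bigr => k _.
by case: (b j) (b k) => u v [u' v'] /=; ring.
Qed.

Lemma cis_inner_bounded (X : Omega -> H) z :
  measurable_fun setT (X : Omega -> borel H) ->
  cbounded_measurable (fun w => cis '<<z, X w>>_H).
Proof.
move=> mX; have [mc ms] := cis_inner_measurable z; split.
- exact: (measurableT_comp mc mX).
- exact: (measurableT_comp ms mX).
- by exists 1 => w /=; rewrite cos_max sin_max.
Qed.

Lemma cintegral_cis_inner s xi : 0 <= s ->
  cintegral P (fun w => cis '<<xi, L s w>>_H) = cexp (- (s%:C * psi xi)).
Proof.
move=> s0; rewrite -(triplet_characteristic_function tri)//.
by congr cintegral; apply/funext => w; rewrite cexp_i.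
Qed.

Lemma cintegral_cst (c : R[i]) : cintegral P (fun=> c) = c.
Proof.
have P1 : fine (P setT) = 1 by rewrite probability_setT.
by apply: complex_ext; rewrite /= Rintegral_cst// -[RHS]mulr1; congr (_ * _).
Qed.

(** Each character e^(i<xi, .>) is an eigenfunction of P_s with eigenvalue e^(-s psi(xi)). *)
Lemma transition_trig (I : finType) (a : I -> R[i]) (xi : I -> H) (f : H -> R) s y :
  0 <= s -> (forall z, (f z)%:C = \sum_i a i * cis '<<xi i, z>>_H) ->
  (transition_semigroup P L s f y)%:C =
  \sum_i a i * cis '<<xi i, y>>_H * cexp (- (s%:C * psi (xi i))).
Proof.
move=> s0 fE; rewrite transition_Rintegral.
have -> : (\int[P]_w f (y + L s w))%:C = cintegral P (fun w => (f (y + L s w))%:C).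
  by apply: complex_ext; rewrite //= Rintegral_cst// mul0r.
have -> : (fun w => (f (y + L s w))%:C) =
    (fun w => \sum_i a i * cis '<<xi i, y>>_H * cis '<<xi i, L s w>>_H).
  by apply/funext => w; rewrite fE; apply: eq_bigr => i _; rewrite innerDr cisD mulrA.
have ic i := cbounded_measurable_integrable P (cis_inner_bounded (xi i) (mL s0)).
rewrite cintegral_sum => [|i]; last exact: cintegrableZ.
by apply: eq_bigr => i _; rewrite cintegralZ// cintegral_cis_inner.
Qed.

(** The second factor is the covariance kernel of the variables e^(phi(xi_j)) e^(i<xi_j, X>), which
    have mean 1; hence it is the Gram kernel of the centred variables [G], and [psd_gram]
    applies. *)
Lemma characteristic_kernel_psd (X : Omega -> H) (phi : H -> R[i])
    (I : finType) (xi : I -> H) (B : I -> I -> R[i]) :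
  measurable_fun setT (X : Omega -> borel H) ->
  (forall z, cintegral P (fun w => cis '<<z, X w>>_H) = cexp (- phi z)) -> psd B ->
  psd (fun j k => B j k *
    (cexp (phi (xi j) + (phi (xi k))^*%C - phi (xi j - xi k)) - 1)).
Proof.
move=> mX phiE hB.
have bc z : cbounded_measurable (fun w => cis '<<z, X w>>_H) by exact: cis_inner_bounded.
pose G j w := cexp (phi (xi j)) * cis '<<xi j, X w>>_H - 1.
have bG j : cbounded_measurable (G j).
  apply: cbounded_measurableD; last exact: cbounded_measurable_cst.
  by apply: cbounded_measurableM => //; exact: cbounded_measurable_cst.
have iG j k : cintegrable P (fun w => G j w * (G k w)^*%C).
  apply: cbounded_measurable_integrable; apply: cbounded_measurableM => //.
  exact: cbounded_measurable_conj.
have := psd_gram iG hB; congr psd; apply/funext => j; apply/funext => k.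
congr (_ * _).
have ic z := cbounded_measurable_integrable P (bc z).
have i1 c : cintegrable P (fun=> c) :=
  cbounded_measurable_integrable P (cbounded_measurable_cst c).
pose ej := cexp (phi (xi j)); pose ek := cexp (phi (xi k)).
(* The expectations of these four terms are the exponential in the claim, -1, -1 and 1. *)
have -> : (fun w => G j w * (G k w)^*%C) = (fun w =>
    ej * ek^*%C * cis '<<xi j - xi k, X w>>_H + (- ej) * cis '<<xi j, X w>>_H +
    (- ek^*%C) * (cis '<<xi k, X w>>_H)^*%C + 1).
  apply/funext => w; rewrite /G -/ej -/ek innerBl cisD -cisJ.
  rewrite rmorphB rmorphM rmorph1 /=; ring.
have I1 := cintegrableZ (ej * ek^*%C) (ic (xi j - xi k)).
have I2 := cintegrableZ (- ej) (ic (xi j)).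
have I3 := cintegrableZ (- ek^*%C) (cintegrable_conj (ic (xi k))).
rewrite (cintegralD (cintegrableD (cintegrableD I1 I2) I3) (i1 1)).
rewrite (cintegralD (cintegrableD I1 I2) I3) (cintegralD I1 I2).
rewrite !cintegralZ//; last exact: cintegrable_conj.
rewrite cintegral_conj// cintegral_cst !phiE !mulNr.
have -> : cexp (phi (xi j) + (phi (xi k))^*%C - phi (xi j - xi k)) =
    ej * ek^*%C * cexp (- phi (xi j - xi k)).
  by rewrite 2!cexpD -cexpJ.
have hj : ej * cexp (- phi (xi j)) = 1 by rewrite mulrC cexpN.
have hk : ek^*%C * (cexp (- phi (xi k)))^*%C = 1.
  by rewrite -rmorphM mulrC cexpN rmorph1.
have alg (u v u' v' y : R[i]) : u * u' = 1 -> v * v' = 1 ->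
    u * v * y - u * u' - v * v' + 1 = u * v * y - 1.
  by move=> -> ->; ring.
exact: alg hj hk.
Qed.

Lemma trig_poly_measurable (f : H -> R) : trig_poly f ->
  measurable_fun setT (f : borel H -> R).
Proof.
move=> [I [a [xi fE]]].
have -> : f = (fun z => \sum_i (complex.Re (a i) * cos '<<xi i, z>>_H -
    complex.Im (a i) * sin '<<xi i, z>>_H)).
  apply/funext => z; rewrite -[LHS]/(complex.Re (f z)%:C) fE.
  by rewrite (big_morph _ (@ReD R) (erefl : complex.Re 0 = 0)); under eq_bigr do rewrite ReM.
apply: measurable_sum => i; have [mc ms] := cis_inner_measurable (xi i).
by apply: measurable_funB; apply: measurable_funM => //; exact: measurable_cst.
Qed.

(* Otherwise [/=] pushes the conjugation inside [cis] and [cexp]. *)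
Local Arguments conjc : simpl never.

Lemma jump_inequality_trig (t : R) (x : H) (f : H -> R) : 0 < t ->
  trig_poly f -> jump_inequality P L t nu x f.
Proof.
move=> t0 trig_f; have [I [a [xi fE]]] := trig_f.
have tge0 := ltW t0.
(* With the eigenvalue and the base point absorbed in the coefficients, y |-> P_t f(x + y) is again
   a trigonometric polynomial with the frequencies [xi]. *)
pose b i := a i * cis '<<xi i, x>>_H * cexp (- (t%:C * psi (xi i))).
pose S := transition_semigroup P L t f.
have SE y : (S (x + y))%:C = \sum_i b i * cis '<<xi i, y>>_H.
  rewrite (transition_trig _ tge0 fE); apply: eq_bigr => i _.
  by rewrite /b innerDr cisD; ring.
pose C j k := cintegral nu (fun y : borel H =>
  (cis '<<xi j, y : H>>_H - 1) * (cis '<<xi k, y : H>>_H - 1)^*%C).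
pose A j k := psi (xi j) + (psi (xi k))^*%C - psi (xi j - xi k).
have AE j k : A j k = C j k + ('<<Q (xi j), xi k>>_H)%:C.
  exact: levy_exponent_gram (triplet_nu_levy tri) _ _ _ _ (triplet_Q_symmetric tri).
have tA s j k : s%:C * A j k =
    s%:C * psi (xi j) + (s%:C * psi (xi k))^*%C - s%:C * psi (xi j - xi k).
  by rewrite /A rmorphM /= conjc_real mulrBr mulrDr.
pose D y := S (x + y) - S x.
have D2E y : (D y ^+ 2)%:C = \sum_j \sum_k b j * (b k)^*%C *
    ((cis '<<xi j, y>>_H - 1) * (cis '<<xi k, y>>_H - 1)^*%C).
  have DE : (D y)%:C = \sum_i b i * (cis '<<xi i, y>>_H - 1).
    rewrite /D rmorphB /= SE -[X in S X]addr0 SE -sumrB; apply: eq_bigr => i _.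
    by rewrite inner0r cis0; ring.
  (* [D y] is real, so its square is [D y] times its conjugate, which is a Hermitian form in b. *)
  rewrite expr2 rmorphM /= -[X in _ * X]conjc_real DE rmorph_sum big_distrlr /=.
  by apply: eq_bigr => j _; apply: eq_bigr => k _; rewrite rmorphM /=; ring.
have S2E : (transition_semigroup P L t (fun z => f z ^+ 2) x)%:C =
    \sum_j \sum_k b j * (b k)^*%C * cexp (t%:C * A j k).
  (* As f is real, f^2 = f conj(f) has the frequencies xi_j - xi_k. Expressing its coefficients
     through b brings in e^(t psi(xi_j)) and the conjugate of e^(t psi(xi_k)), which complete the
     exponent to t A_jk. *)
  pose a2 (p : I * I) := a p.1 * (a p.2)^*%C.
  rewrite (@transition_trig _ a2 (fun p => xi p.1 - xi p.2) _ _ _ tge0).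
    rewrite pair_bigA; apply: eq_bigr => -[j k] _ /=.
    rewrite tA /b; move: (t%:C * psi (xi j)) (t%:C * psi (xi k)) => pj pk.
    rewrite 2!cexpD -cexpJ 2!rmorphM /= innerBl cisD -cisJ /a2 /=.
    have hk : (cexp (- pk))^*%C * (cexp pk)^*%C = 1 by rewrite -rmorphM cexpN rmorph1.
    have alg (u v c e y z1 z1' z2 z2' : R[i]) : z1 * z1' = 1 -> z2 * z2' = 1 ->
        u * v * (c * e) * y = u * c * z1 * (v * e * z2) * (z1' * z2' * y).
      move=> h1 h2; transitivity (u * v * c * e * y * (z1 * z1') * (z2 * z2')).
        by rewrite h1 h2; ring.
      by ring.
    exact: alg (cexpN pj) hk.
  move=> z; rewrite expr2 rmorphM /= -[X in _ * X]conjc_real fE rmorph_sum big_distrlr /=.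
  rewrite pair_bigA; apply: eq_bigr => -[j k] _ /=.
  by rewrite rmorphM /= cisJ innerBl cisD /a2 /=; ring.
have iC : cintegrable nu (fun y : borel H => (D (y : H) ^+ 2)%:C).
  under [X in cintegrable _ X]eq_fun do rewrite D2E.
  apply: cintegrable_sum => j; apply: cintegrable_sum => k; apply: cintegrableZ.
  exact: cintegrable_cisB1M (triplet_nu_levy tri) _ _.
split.
- exact: trig_poly_measurable.
- exact: trig_poly_bounded.
- by apply: trig_poly_measurable; exists I, b, xi.
rewrite -/S; under eq_integral do rewrite real_normK ?num_real//.
have iD := integrable_fin_num measurableT iC.1.
(* The jump integral is finite, so the comparison is between real numbers. *)
rewrite -[leLHS]fineK// lee_fin.
have -> : fine (\int[nu]_y ((S (x + y) - S x) ^+ 2)%:E)%E =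
    complex.Re (\sum_j \sum_k b j * (b k)^*%C * C j k).
  transitivity (complex.Re (cintegral nu (fun y : borel H => (D (y : H) ^+ 2)%:C))) => //.
  under [X in cintegral _ X]eq_fun do rewrite D2E.
  have iM j k := cintegrable_cisB1M (triplet_nu_levy tri) (xi j) (xi k).
  rewrite cintegral_sum => [|j]; last first.
    by apply: cintegrable_sum => k; exact: cintegrableZ.
  congr complex.Re; apply: eq_bigr => j _.
  rewrite cintegral_sum => [|k]; last exact: cintegrableZ.
  by apply: eq_bigr => k _; rewrite cintegralZ.
(* A - C is the Gaussian kernel of [Q], whose form is nonnegative. *)
have CA : complex.Re (\sum_j \sum_k b j * (b k)^*%C * C j k) <=
    complex.Re (\sum_j \sum_k b j * (b k)^*%C * A j k).
  rewrite -subr_ge0; have := nonnegative_gram b xi; congr (0 <= _).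
  apply/eqP; rewrite eq_sym subr_eq -ReD; apply/eqP; congr complex.Re.
  rewrite -big_split; apply: eq_bigr => j _; rewrite -big_split; apply: eq_bigr => k _.
  by rewrite AE /=; ring.
apply: le_trans CA _; rewrite ler_pdivlMl//.
rewrite -[leRHS]/(complex.Re (transition_semigroup P L t (fun z => f z ^+ 2) x)%:C) S2E.
(* The law of [L s] has exponent s psi with the same psi for every s >= 0; this gives positivity at
   the small times t/n as well. *)
have hA s B : 0 <= s -> psd B -> psd (fun j k => B j k * (cexp (s%:C * A j k) - 1)).
  move=> s0 /(characteristic_kernel_psd xi (mL s0) (fun z => cintegral_cis_inner z s0)).
  congr psd; apply/funext => j; apply/funext => k; congr (_ * (cexp _ - 1)).
  by rewrite tA.
apply: le_trans (psd_cexp_le b t0 hA).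
have ReZ z : t * complex.Re z = complex.Re (t%:C * z) by rewrite ReM /= mul0r subr0.
rewrite ReZ mulr_sumr le_eqVlt; apply/orP; left; apply/eqP; congr complex.Re.
apply: eq_bigr => j _; rewrite mulr_sumr; apply: eq_bigr => k _.
by rewrite mulrCA.
Qed.

End TrigInequality.

(* From trigonometric polynomials to bounded Borel functions *)
Local Close Scope complex_scope.

Theorem corollary3p2 (R : realType) (H : hilbertType R) (hH : separable H)
    (d : measure_display) (Omega : measurableType d) (P : probability Omega R)
    (L : R -> Omega -> H) (m : H) (Q : {linear H -> H})
    (nu : {measure set (borel H) -> \bar R})
    (hL : levy_process P L) (htriplet : generating_triplet P L m Q nu)
    (f : H -> R) (hf : bounded_borel f) (x : H) (t : R) (ht : 0 < t) :
  (\int[nu]_y ((`|transition_semigroup P L t f (x + y)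
                  - transition_semigroup P L t f x| ^+ 2)%:E)
   <= (t^-1 * transition_semigroup P L t (fun z => f z ^+ 2) x)%:E)%E.
Proof.
have mL := levy_measurable hL.
suff [] : jump_inequality P L t nu x f by [].
(* Separability places [f] in the bounded closure of the trigonometric polynomials, so the
   inequality is needed for these and under bounded limits. *)
move: f hf => f /(trig_poly_closure hH); apply: bounded_closure_ind.
  by move=> g; exact: (jump_inequality_trig mL htriplet).
by apply: jump_inequality_closed; exact: mL (ltW ht).
Qed.
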